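(* There exist absolute constants $C>0$ and $c_0>0$ such that the following holds. Let $p\ge 3$ be a prime number and let $\gamma\in\mathbb{F}_p^*$ be a primitive root. Let $\varepsilon_1,\varepsilon_2,\dots$ be independent random variables distributed uniformly on $\{\gamma,\gamma^{-1}\}$. Consider the lazy Markov chain $X_0,X_1,\dots,X_n,\dots$ on $\mathbb{F}_p^*$, with an arbitrary starting point $X_0\in\mathbb{F}_p^*$, defined by $$X_{j+1}=\begin{cases} f_*(X_j)\cdot\varepsilon_{j+1} & \text{with probability } 1/2,\\ X_j & \text{with probability } 1/2.\end{cases}$$ Then for every $c>0$ and every positive integer $n$ of the form $n=c\exp(C\log p/\log\log p)$ one has $$\|P_n-U\|:=\frac12\max_{A\subseteq\mathbb{F}_p^*}\left|\mathrm{P}(X_n\in A)-\frac{|A|}{p-1}\right|\le e^{-c_0c}.$$ The same is true for the chain $X_{j+1}=f_*(X_j)\cdot\varepsilon_{j+1}$ on $\mathbb{F}_p^*$, where now the $\varepsilon_j$ are independent random variables distributed uniformly on $\{1,\gamma^{-1},\gamma\}$.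
   Context: $\mathbb{F}_p=\mathbb{Z}/p\mathbb{Z}$ and $\mathbb{F}_p^*=\mathbb{F}_p\setminus\{0\}$. The function $f_*:\mathbb{F}_p^*\to\mathbb{F}_p^*$ is $f_*(x)=\frac{x}{x-1}$ for $x\ne 1$, with the convention $f_*(1)=1$ (so that $f_*$ is a bijection). The choice to move or to stay is made independently at every step. All logarithms are to base $2$. *)

(* Defs.v *)
From mathcomp Require Import all_boot all_order all_algebra.
From mathcomp Require Import all_classical all_reals all_analysis.
Set Implicit Arguments.
Unset Strict Implicit.
Unset Printing Implicit Defensive.
Import Order.TTheory GRing.Theory Num.Theory.
Local Open Scope classical_set_scope.
Local Open Scope ring_scope.

Definition log2 (R : realType) (x : R) : R := ln x / ln 2.

Section RandomVariables.
Context d (T : measurableType d) (R : realType) (P : probability T R).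

(* Measurability for the discrete sigma-algebra on the codomain, which is only
   required to be a bare type ('F_p has no measurableType instance). *)
Definition discrete_rv (E : Type) (Z : T -> E) : Prop :=
  forall B : set E, measurable (Z @^-1` B).

(* S is a set: coinciding elements (e.g. g = g^-1 in 'F_3) are counted once. *)
Definition uniform_on (E : finType) (S : {set E}) (Z : T -> E) : Prop :=
  forall x : E,
    P (Z @^-1` [set x]) = (if x \in S then #|S|%:R^-1 else 0 : R)%:E.

Definition sigma_of (E : Type) (Z : T -> E) : set_system T :=
  preimage_set_system setT Z setT.

Definition independent (I : eqType) (F : I -> set_system T) : Prop :=
  forall (J : seq I) (B : I -> set T),
    uniq J -> (forall i, i \in J -> F i (B i)) ->
    P (\bigcap_(i in [set` J]) B i) = (\prod_(i <- J) P (B i))%E.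

Definition independent_rvs (E : Type) (Z : nat -> T -> E) : Prop :=
  independent (fun j => sigma_of (Z j)).

Definition independent_rvs2 (E1 E2 : Type)
    (Z : nat -> T -> E1) (W : nat -> T -> E2) : Prop :=
  independent (fun k : nat + nat =>
    match k with inl j => sigma_of (Z j) | inr j => sigma_of (W j) end).

End RandomVariables.

Definition Fpstar (p : nat) : {set 'F_p} := [set x : 'F_p | x != 0]%SET.

Definition fstar (p : nat) (x : 'F_p) : 'F_p :=
  if x == 1 then 1 else x / (x - 1).

(* The increments are indexed from 0: eps j and move j, for j >= 0, govern the
   step from time j to time j + 1. *)
Fixpoint chain (p : nat) (T : Type) (x0 : 'F_p) (eps : nat -> T -> 'F_p)
    (n : nat) (w : T) : 'F_p :=
  if n is j.+1 then fstar (chain x0 eps j w) * eps j w else x0.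

Fixpoint lazy_chain (p : nat) (T : Type) (x0 : 'F_p) (eps : nat -> T -> 'F_p)
    (move : nat -> T -> bool) (n : nat) (w : T) : 'F_p :=
  if n is j.+1 then
    let x := lazy_chain x0 eps move j w in
    if move j w then fstar x * eps j w else x
  else x0.

(* The terms of the maximum are nonnegative, so the default value 0 is
   harmless. *)
Definition dist_to_uniform d (T : measurableType d) (R : realType)
    (P : probability T R) (p : nat) (Z : T -> 'F_p) : R :=
  2^-1 * \big[Num.max/0]_(A : {set 'F_p} | A \subset Fpstar p)
    `| fine (P [set w | Z w \in A]) - #|A|%:R / (p%:R - 1) |.

(* Main.v *)
Require Import Defs.
From mathcomp Require Import all_boot all_order all_algebra.
From mathcomp Require Import all_classical all_reals all_analysis.
From mathcomp Require Import zify ring lra.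
Set Implicit Arguments.
Unset Strict Implicit.
Unset Printing Implicit Defensive.
Import Order.TTheory GRing.Theory Num.Theory.
Local Open Scope classical_set_scope.
Local Open Scope ring_scope.

(** In the coordinate y = 1/x the map f_* becomes the reflection y |-> 1 - y of
F_p, except that the state 0, which the reflection exchanges with 1, is skipped.
So the chain is a random walk by affine maps of F_p watched on F_p^*, and its
speed depends on one question: how small must a function g of sum zero be if, in
mean square, it is almost invariant under multiplication by theta and under its
conjugate by f_*?  Here theta is gamma, or gamma^2 for the lazy chain.  Skipping
0 costs nothing, because giving the function at 0 the value it has at 1 keeps
both mean-square variations unchanged ([reciprocal_dilation],
[reciprocal_reflection]).

The multiplication by theta^-1 followed by y |-> 1 - theta (1 - y) is the
translation by b = 1 - theta; conjugating it by powers of theta shows that the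
function is almost invariant under all the translations by b theta^j.  By
Fourier inversion on F_p this forces the function to be small as soon as every
nonzero z has a multiple z theta^j, with j in a short range, whose distance to 0
modulo p is a fair fraction of p ([poincare_translations], [chain_gap]).

That last fact is [orbit_escapes].  Suppose that the centered residues r_j of
z theta^j are all small.  If (H + 1)^(D + 1) > p, then by the pigeonhole
principle theta is a root modulo p of a nonzero integer polynomial of degree
d <= D with coefficients bounded by H, and smallness upgrades the congruences
between the r_j to an exact linear recurrence over the integers.  The solutions
of the recurrence form a space of dimension d, in which a sequence is controlled
everywhere by its values at d well-chosen nodes ([interpolation_nodes]).  Among
(4 D)^D + 1 shifts of r two are close at these nodes, hence close everywhere:
their difference lifts the orbit of another nonzero point and is half as large
([halving]).  After log p halvings a nonzero residue is lifted by 0, which is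
absurd.  With D close to log log p and H close to p^(1/D), every quantity in the
argument is exp(O(log p / log log p)) ([escape_parameters], [growth]).  If p is
so small that the powers of theta involved may coincide, then p itself obeys
this bound and there is nothing to prove.

Finally, averaging a function over injective maps loses at least a multiple of
the energy of the difference along any two of them ([mixture_energy]).  One of
the maps is the identity: for the lazy chain because it may stay, for the other
one, over two steps, because f_* is an involution and 1 is an allowed factor.
So the deviation from uniformity decays geometrically in mean square, and the
factor p lost between mean square and total variation is absorbed by the
constant C. *)

(** * Interpolation nodes for linear recurrences *)

(** Choosing the d rows of largest determinant, Cramer's rule expresses the
coordinates of any other row as quotients of two determinants, the larger of
which is the denominator. *)
Lemma auerbach_rows (F : realFieldType) (n d : nat) (A : 'M[F]_(n, d))
    (f0 : 'I_d -> 'I_n) : \det (rowsub f0 A) != 0 ->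
  exists f : 'I_d -> 'I_n, forall j, exists2 c : 'rV[F]_d,
    row j A = c *m rowsub f A & forall b, `|c 0 b| <= 1.
Proof.
move=> det0; pose D (f : {ffun 'I_d -> 'I_n}) := `|\det (rowsub f A)|.
pose g0 : {ffun 'I_d -> 'I_n} := [ffun b => f0 b].
have D0 : 0 < D g0.
  rewrite normr_gt0 (_ : rowsub g0 A = rowsub f0 A) //.
  by apply/matrixP => i j; rewrite !mxE ffunE.
case: (arg_maxP (P := xpredT) D (i0 := g0) isT) => f _ fmax.
exists f => j; set B := rowsub f A.
have detB : 0 < `|\det B| := lt_le_trans D0 (fmax g0 isT).
have Bu : B \in unitmx by rewrite unitmxE unitfE -normr_gt0.
exists (row j A *m invmx B); first by rewrite mulmxKV.
move=> b; set c := row j A *m invmx B.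
(* Cramer: the b-th coordinate is the quotient of the determinant obtained by
   exchanging the b-th node for j by the one that was chosen maximal. *)
have -> : c 0 b = (\det B)^-1 *
    \det (rowsub [ffun i => if i == b then j else f i] A).
  rewrite /c /invmx Bu -scalemxAr mxE; congr (_ * _).
  rewrite (expand_det_row _ b) mxE; apply: eq_bigr => i _; rewrite !mxE ffunE eqxx.
  congr (_ * _).
  rewrite /cofactor; congr (_ * \det _).
  by apply/matrixP => u v; rewrite !mxE ffunE eq_sym (negPf (neq_lift _ _)).
by rewrite normrM normfV ler_pdivrMl // mulr1; apply: fmax.
Qed.

(** The row indexed by j holds the coefficients of the j-th term of a solution as a
linear form in its first d terms; they are rational because the leading
coefficient of the recurrence need not be a unit. *)
Lemma recurrence_rows (d n : nat) (q : nat -> int) : q d != 0 ->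
  exists a : nat -> 'rV[rat]_d,
    (forall i : 'I_d, a i = delta_mx 0 i) /\
    forall j, (j < n)%N -> \sum_(i < d.+1) (q i)%:~R *: a (j + i)%N = 0.
Proof.
move=> qd; elim: n => [|n [a [a0 an]]].
  exists (fun k => \row_i (k == i :> nat)%:R); split => // i.
  by apply/rowP => k; rewrite !mxE eqxx /= eq_sym.
pose v := - (q d)%:~R^-1 *: \sum_(i < d) (q i)%:~R *: a (n + i)%N.
exists (fun k => if k == (n + d)%N then v else a k); split => [i|j].
  by rewrite ifN ?a0 // neq_ltn (leq_trans (ltn_ord i)) ?leq_addl.
rewrite ltnS leq_eqVlt => /orP[/eqP->|jn].
  rewrite big_ord_recr /= eqxx /v scalerA mulrN mulfV ?intr_eq0 // scaleN1r.
  apply/eqP; rewrite subr_eq0; apply/eqP; apply: eq_bigr => i _.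
  by rewrite ifN // eqn_add2l neq_ltn ltn_ord.
rewrite -[RHS](an j jn); apply: eq_bigr => i _; rewrite ifN //.
by have := ltn_ord i; lia.
Qed.

(** A solution is determined by its first d terms, but these control the later ones
with exponentially bad constants.  The nodes of largest determinant control all
terms with constants at most 1. *)
Lemma interpolation_nodes (d n : nat) (q : nat -> int) : q d != 0 -> (d <= n)%N ->
  exists f : 'I_d -> nat, (forall b, f b < n)%N /\
    forall y : nat -> int,
      (forall j, (j + d < n)%N -> \sum_(i < d.+1) q i * y (j + i)%N = 0) ->
      forall j, (j < n)%N -> `|y j| <= \sum_(b < d) `|y (f b)|.
Proof.
move=> qd dn; have [a [a0 an]] := recurrence_rows n qd.
pose A : 'M[rat]_(n, d) := \matrix_(j < n) a j.
have detA : \det (rowsub (widen_ord dn) A) != 0.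
  rewrite (_ : rowsub _ _ = 1%:M) ?det1 ?oner_eq0 //.
  by apply/matrixP => i k; rewrite !mxE /= a0 mxE eqxx /= eq_sym.
have [f fP] := auerbach_rows detA.
exists (fun b => f b); split => [b|y yrec]; first exact: ltn_ord.
have sol k : (k < n)%N -> (y k)%:~R = \sum_(i < d) a k 0 i * (y i)%:~R.
  elim/ltn_ind: k => k IH kn; have [kd|dk] := ltnP k d.
    rewrite (a0 (Ordinal kd)) (bigD1 (Ordinal kd)) //= big1 => [|i ik].
      by rewrite mxE !eqxx mul1r addr0.
    by rewrite mxE (negPf ik) mul0r.
  have kE : k = (k - d + d)%N by rewrite subnK.
  have jn : (k - d < n)%N by lia.
  have qd' : (q d)%:~R != 0 :> rat by rewrite intr_eq0.
  apply: (mulfI qd').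
  have := congr1 (fun z => z%:~R : rat) (yrec (k - d)%N ltac:(lia)).
  have := an (k - d)%N jn.
  rewrite !big_ord_recr /= -kE rmorphD rmorph_sum /= rmorphM /=.
  move=> /eqP; rewrite addrC addr_eq0 => /eqP ak.
  move=> /eqP; rewrite addrC addr_eq0 => /eqP ->.
  rewrite mulr_sumr.
  have ake i : (q d)%:~R * a k 0 i = - \sum_(u < d) (q u)%:~R * a (k - d + u)%N 0 i.
    have := congr1 (fun M : 'rV_d => M 0 i) ak; rewrite mxE => ->.
    by rewrite mxE summxE; congr (- _); apply: eq_bigr => u _; rewrite mxE.
  under [RHS]eq_bigr => i _ do rewrite mulrA ake mulNr mulr_suml.
  rewrite sumrN exchange_big /=; congr (- _); apply: eq_bigr => u _.
  have ud := ltn_ord u.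
  rewrite rmorphM /= IH; [|lia|lia].
  by rewrite mulr_sumr; apply: eq_bigr => i _; rewrite mulrA.
move=> j jn; have [c cE c1] := fP (Ordinal jn).
rewrite -(ler_int rat) intr_norm sol // rmorph_sum /=.
have ajE i : a j 0 i = \sum_b c 0 b * a (f b) 0 i.
  have := congr1 (fun M : 'rV_d => M 0 i) cE; rewrite !mxE /= => ->.
  by apply: eq_bigr => b _; rewrite !mxE.
have -> : \sum_(i < d) a j 0 i * (y i)%:~R = \sum_b c 0 b * (y (f b))%:~R.
  under eq_bigr => i _ do rewrite ajE mulr_suml.
  rewrite exchange_big /=; apply: eq_bigr => b _; rewrite sol // mulr_sumr.
  by apply: eq_bigr => i _; rewrite mulrA.
apply: le_trans (ler_norm_sum _ _ _) _; apply: ler_sum => b _.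
by rewrite normrM intr_norm ler_piMl.
Qed.

(** * Orbits of multiplication modulo p leave every small interval *)

Lemma Fp_int_eq0 (p : nat) (z : int) : prime p ->
  (z%:~R == 0 :> 'F_p) = (p %| `|z|)%N.
Proof.
move=> pp; rewrite -{1}[z]intz {1}[z]intEsign intz rmorphM /= mulf_eq0.
rewrite rmorphXn rmorphN1 signr_eq0 /= -pmulrn.
by rewrite (dvdn_pcharf (pchar_Fp pp)).
Qed.

Lemma small_relation (p D H : nat) (theta : 'F_p) : prime p ->
  (p < H.+1 ^ D.+1)%N ->
  exists d (q : nat -> int), [/\ (d <= D)%N, q d != 0,
    forall i, (`|q i| <= H)%N & \sum_(i < d.+1) (q i)%:~R * theta ^+ i = 0].
Proof.
move=> pp pH.
pose ev (h : {ffun 'I_D.+1 -> 'I_H.+1}) : 'F_p :=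
  \sum_(i < D.+1) (h i)%:R * theta ^+ i.
have /injectivePn[h [h' hh' evhh']] : ~~ injectiveb ev.
  apply: contraL pH => /injectiveP/leq_card; rewrite card_ffun !card_ord.
  by rewrite -leqNgt Fp_cast.
pose q k : int := if (k <= D)%N then (h (inord k))%:Z - (h' (inord k))%:Z else 0.
have qE (i : 'I_D.+1) : q i = (h i)%:Z - (h' i)%:Z.
  by rewrite /q -ltnS ltn_ord inord_val.
have qH i : (`|q i| <= H)%N.
  rewrite /q; case: ifP => // _.
  by have := ltn_ord (h (inord i)); have := ltn_ord (h' (inord i)); lia.
have ex : exists k, (k <= D)%N && (q k != 0).
  have [i hi] : exists i, h i != h' i.
    apply/existsP; apply: contra_neqT hh'; rewrite negb_exists => /forallP E.
    by apply/ffunP => i; apply/eqP; have := E i; rewrite negbK.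
  exists i; rewrite -ltnS ltn_ord qE subr_eq0.
  by apply: contra_neq hi => -[]; apply: val_inj.
have bd k : (k <= D)%N && (q k != 0) -> (k <= D)%N by case/andP.
case: (ex_maxnP ex bd) => d /andP[dD qd] dmax.
exists d, q; split => //.
have sum0 : \sum_(i < D.+1) (q i)%:~R * theta ^+ i = 0.
  under eq_bigr => i _ do rewrite qE rmorphB /= -!pmulrn mulrBl.
  by rewrite sumrB; apply/eqP; rewrite subr_eq0; apply/eqP.
rewrite (big_ord_widen D.+1 (fun i => (q i)%:~R * theta ^+ i)) //.
apply: etrans sum0; rewrite [RHS](bigID (fun i : 'I_D.+1 => (i < d.+1)%N)) /=.
rewrite [X in _ = _ + X]big1 ?addr0 // => i; rewrite -leqNgt => di.
suff /eqP-> : q i == 0 by rewrite mul0r.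
apply: contraTT di => qi; rewrite -ltnNge ltnS dmax // qi andbT.
by rewrite -ltnS.
Qed.

Definition lifts_orbit (p : nat) (theta zeta : 'F_p) (n : nat) (y : nat -> int) :=
  forall j, (j < n)%N -> (y j)%:~R = zeta * theta ^+ j.

Definition solves (d : nat) (q : nat -> int) (n : nat) (y : nat -> int) :=
  forall j, (j + d < n)%N -> \sum_(i < d.+1) q i * y (j + i)%N = 0.

(** The congruences hold modulo p, and both sides are smaller than p, so that they
are equalities of integers. *)
Lemma small_lift_solves (p d H B n : nat) (theta zeta : 'F_p) (q y : nat -> int) :
  prime p -> (forall i, (`|q i| <= H)%N) ->
  \sum_(i < d.+1) (q i)%:~R * theta ^+ i = 0 ->
  lifts_orbit theta zeta n y -> (forall j, (j < n)%N -> (`|y j| <= B)%N) ->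
  (d.+1 * H * B < p)%N -> solves d q n y.
Proof.
move=> pp qH rel lif yB small j jd; set z := (X in X = 0).
have zp : (p %| `|z|)%N.
  rewrite -(Fp_int_eq0 _ pp) /z rmorph_sum /=.
  have := congr1 ( *%R (zeta * theta ^+ j)) rel; rewrite mulr0 mulr_sumr => E.
  apply/eqP; apply: etrans E; apply: eq_bigr => i _.
  rewrite rmorphM /= lif; last by have := ltn_ord i; lia.
  by rewrite exprD; ring.
have zs : (`|z| <= d.+1 * H * B)%N.
  rewrite -lez_nat abszE /z; apply: le_trans (ler_norm_sum _ _ _) _.
  apply: le_trans (_ : \sum_(i < d.+1) (H * B)%:Z <= _).
    apply: ler_sum => i _; rewrite -abszE abszM lez_nat leq_mul // yB //.
    by have := ltn_ord i; lia.
  by rewrite sumr_const card_ord -mulr_natl natz -PoszM mulnA.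
apply/eqP; rewrite -absz_eq0; apply: contraTT zs => z0.
by rewrite -ltnNge (leq_trans small) // dvdn_leq // lt0n.
Qed.

Lemma same_cell (L B : nat) (a a' : int) :
  (absz a <= B)%N -> (absz a' <= B)%N ->
  (absz (a + B%:Z)%R * L %/ (2 * B).+1 = absz (a' + B%:Z)%R * L %/ (2 * B).+1)%N ->
  (absz (a - a')%R * L <= 2 * B)%N.
Proof.
move=> aB aB'.
have -> : absz (a - a') = ((absz (a + B%:Z)%R - absz (a' + B%:Z)%R) +
    (absz (a' + B%:Z)%R - absz (a + B%:Z)%R))%N by lia.
move: (absz _) (absz _) => w w' E; rewrite mulnDl !mulnBl.
have := divn_eq (w * L) (2 * B).+1; have := divn_eq (w' * L) (2 * B).+1.
have := ltn_pmod (w * L) (ltn0Sn (2 * B)).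
have := ltn_pmod (w' * L) (ltn0Sn (2 * B)).
rewrite E; set Q := (_ %/ _ * _)%N; set r := (_ %% _)%N; set r' := (_ %% _)%N.
move: Q r r' (w * L)%N (w' * L)%N => Q r r' W W'; lia.
Qed.

(** The vectors of values of the shifted sequences at the d nodes lie in a cube of
side 2B cut into (4D)^d cells, so two of the shifts fall into one cell; the nodes
then bound their difference everywhere by d 2B/(4D), which is at most B/2.  The
difference lifts a nonzero orbit because the powers of theta are distinct. *)
Lemma halving (p d D B n : nat) (theta zeta : 'F_p) (q y : nat -> int) :
  prime p -> (0 < D)%N -> (d <= D)%N -> (D <= n)%N -> q d != 0 ->
  {in gtn ((4 * D) ^ D).+1 &, injective (fun t => theta ^+ t)} ->
  zeta != 0 ->
  lifts_orbit theta zeta (n + (4 * D) ^ D) y -> solves d q (n + (4 * D) ^ D) y ->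
  (forall j, (j < n + (4 * D) ^ D)%N -> (`|y j| <= B)%N) ->
  exists zeta' y', [/\ zeta' != 0, lifts_orbit theta zeta' n y', solves d q n y' &
    forall j, (j < n)%N -> (`|y' j| <= B./2)%N].
Proof.
set L := (4 * D)%N; set T := (L ^ D)%N.
move=> pp D0 dD Dn qd inj zeta0 lif sol yB.
have L0 : (0 < L)%N by rewrite muln_gt0.
have [f [fn fP]] := interpolation_nodes qd (leq_trans dD Dn).
pose v t b := absz (y (t + f b)%N + B%:Z).
have tfb (t : 'I_T.+1) b : (t + f b < n + T)%N.
  by have := ltn_ord t; have := fn b; lia.
have cell_lt (t : 'I_T.+1) b : (v t b * L %/ (2 * B).+1 < L)%N.
  rewrite ltn_divLR // mulnC ltn_mul2l L0 ltnS /=.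
  by have := yB _ (tfb t b); rewrite /v; lia.
pose cell (t : 'I_T.+1) : {ffun 'I_d -> 'I_L} := [ffun b => Ordinal (cell_lt t b)].
have /injectivePn[t [t' tt' /ffunP cE]] : ~~ injectiveb cell.
  apply/negP => /injectiveP/leq_card; rewrite card_ffun !card_ord.
  by rewrite leqNgt ltnS leq_pexp2l.
pose y' j := y (t + j)%N - y (t' + j)%N.
have tT := ltn_ord t; have tT' := ltn_ord t'.
have solshift u : (u <= T)%N -> solves d q n (fun j => y (u + j)%N).
  move=> uT j jd; apply: etrans (sol (u + j)%N _); last by lia.
  by apply: eq_bigr => i _; rewrite addnA.
have sol' : solves d q n y'.
  move=> j jd.
  have := congr2 (fun a b => a - b) (solshift t tT j jd) (solshift t' tT' j jd).
  rewrite subr0 -sumrB; apply: etrans.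
  by apply: eq_bigr => i _; rewrite mulrBr.
exists (zeta * (theta ^+ t - theta ^+ t')), y'; split => //.
- rewrite mulf_neq0 // subr_eq0; apply: contra_neq tt' => /inj.
  by rewrite !inE => /(_ tT tT') /val_inj.
- move=> j jn; rewrite /y' rmorphB /= !lif; [|lia|lia].
  by rewrite !exprD; ring.
- have node b : (`|y' (f b)| * L <= 2 * B)%N.
    have /(congr1 val) := cE b; rewrite !ffunE /=.
    by apply: same_cell; apply: yB; apply: tfb.
  move=> j jn; have := fP _ sol' j jn => yb.
  have : (`|y' j| * L <= D * (2 * B))%N.
    apply: (@leq_trans ((\sum_(b < d) `|y' (f b)|) * L)%N).
      rewrite leq_mul2r -lez_nat; apply/orP; right.
      rewrite abszE (le_trans yb) // -natz natr_sum; apply: ler_sum => b _.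
      by rewrite natz abszE.
    rewrite big_distrl /=; apply: (@leq_trans (\sum_(b < d) 2 * B)%N).
      by apply: leq_sum => b _; exact: node.
    by rewrite sum_nat_const card_ord leq_mul2r dD orbT.
  have -> : (D * (2 * B) = (B * 2) * D)%N by ring.
  rewrite /L mulnA leq_pmul2r // => h; lia.
Qed.

(** Each halving shortens the range of indices by (4D)^D, and s of them turn a
sequence bounded by B < 2^s into 0. *)
Lemma orbit_escapes (p D H s n : nat) (theta zeta : 'F_p) (y : nat -> int) :
  prime p -> (0 < D)%N -> (p < H.+1 ^ D.+1)%N -> (p <= 2 ^ s)%N ->
  {in gtn ((4 * D) ^ D).+1 &, injective (fun t => theta ^+ t)} ->
  zeta != 0 -> n = (D + s * (4 * D) ^ D)%N -> lifts_orbit theta zeta n y ->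
  exists2 j, (j < n)%N & (p <= D.+1 * H * `|y j|)%N.
Proof.
move=> pp D0 pH ps inj zeta0 -> lif; set n' := (D + _)%N.
have [/existsP[j pj]|] := boolP [exists j : 'I_n', (p <= D.+1 * H * `|y j|)%N].
  by exists j.
rewrite negb_exists => /forallP small; exfalso.
have p0 := prime_gt0 pp.
have H0 : (0 < H)%N.
  by case: H pH {small} => //; rewrite exp1n ltnS leqNgt p0.
have DH0 : (0 < D.+1 * H)%N by rewrite muln_gt0.
pose B := (p.-1 %/ (D.+1 * H))%N.
have yB j : (j < n')%N -> (`|y j| <= B)%N.
  move=> jn; have := small (Ordinal jn); rewrite -ltnNge /= => h.
  by rewrite leq_divRL // mulnC; lia.
have [d [q [dD qd qH rel]]] := small_relation theta pp pH.
have sol : solves d q n' y.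
  apply: (@small_lift_solves p d H B n' theta zeta) => //.
  apply: (@leq_ltn_trans p.-1); last by lia.
  rewrite (leq_trans _ (leq_trunc_div p.-1 (D.+1 * H))) // mulnC leq_mul2l.
  by rewrite leq_mul2r ltnS dD !orbT.
have Bs : (B < 2 ^ s)%N by apply: leq_ltn_trans (leq_div _ _) _; lia.
move: B y zeta zeta0 lif sol yB Bs {small}; rewrite /n' {ps n'}.
elim: s => [|s IH] B y zeta zeta0 lif sol yB Bs.
  have n0 : (0 < D + 0 * (4 * D) ^ D)%N by rewrite ltn_addr.
  have := yB 0%N n0; move: Bs; rewrite expn0 ltnS leqn0 => /eqP ->.
  rewrite leqn0 absz_eq0 => /eqP y0; have := lif 0%N n0.
  by rewrite y0 expr0 mulr1 => /esym/eqP; apply/negP.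
have nE : (D + s.+1 * (4 * D) ^ D = D + s * (4 * D) ^ D + (4 * D) ^ D)%N.
  by rewrite mulSn; ring.
rewrite nE in lif sol yB.
have [zeta' [y' [z0' lif' sol' yB']]] :=
  halving pp D0 dD (leq_addr _ _) qd inj zeta0 lif sol yB.
apply: (IH B./2 y' zeta') => //.
by move: Bs; rewrite expnS; lia.
Qed.

(** * Fourier analysis on the prime field by cosines *)

Definition centered (p : nat) (u : 'F_p) : int :=
  if (2 * u <= p)%N then u%:Z else u%:Z - p%:Z.

Lemma centeredE (p : nat) (u : 'F_p) : prime p -> (centered u)%:~R = u.
Proof.
move=> pp; have uu : (u%:Z)%:~R = u by rewrite -pmulrn natr_Zp.
rewrite /centered; case: ifP => // _.
by rewrite rmorphB /= uu -[p%:~R]pmulrn pchar_Fp_0 // subr0.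
Qed.

Section Characters.
Variables (R : realType) (p : nat).
Hypothesis pp : prime p.

Definition angle (n : nat) : R := pi *+ 2 * n%:R / p%:R.
(** The real and imaginary parts of the additive characters of F_p; they suffice
because all functions in sight are real. *)
Definition fcos (u : 'F_p) : R := cos (angle u).
Definition fsin (u : 'F_p) : R := sin (angle u).

Let p0 : p%:R != 0 :> R.
Proof. by rewrite pnatr_eq0 -lt0n prime_gt0. Qed.

Lemma angleD m n : angle (m + n) = angle m + angle n.
Proof. by rewrite /angle natrD mulrDr mulrDl. Qed.

Lemma angle_period m k : angle (m + k * p) = angle m + (pi *+ 2) *+ k.
Proof.
rewrite angleD; congr (_ + _).
by rewrite /angle natrM mulrA mulfK // mulr_natr.
Qed.

Lemma fcos_nat n : fcos n%:R = cos (angle n).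
Proof.
rewrite /fcos /= val_Fp_nat // {2}(divn_eq n p) addnC angle_period.
by rewrite (periodicn (@cosD2pi R)).
Qed.

Lemma fsin_nat n : fsin n%:R = sin (angle n).
Proof.
rewrite /fsin /= val_Fp_nat // {2}(divn_eq n p) addnC angle_period.
by rewrite (periodicn (@sinD2pi R)).
Qed.

Lemma fcos0 : fcos 0 = 1.
Proof. by rewrite /fcos /angle mulr0 mul0r cos0. Qed.

Lemma fcosD u v : fcos (u + v) = fcos u * fcos v - fsin u * fsin v.
Proof.
by rewrite -{1}[u]natr_Zp -{1}[v]natr_Zp -natrD fcos_nat angleD cosD.
Qed.

Lemma fsinD u v : fsin (u + v) = fsin u * fcos v + fcos u * fsin v.
Proof.
by rewrite -{1}[u]natr_Zp -{1}[v]natr_Zp -natrD fsin_nat angleD sinD.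
Qed.

Lemma fcos2Dfsin2 u : fcos u ^+ 2 + fsin u ^+ 2 = 1.
Proof. exact: cos2Dsin2. Qed.

Lemma fcosB u v : fcos (u - v) = fcos u * fcos v + fsin u * fsin v.
Proof.
have := fcos2Dfsin2 v; have := fcosD (u - v) v; have := fsinD (u - v) v.
by rewrite subrK => -> -> E; rewrite -[LHS]mulr1 -E; ring.
Qed.

Lemma fcos_centered u : fcos u = cos (angle `|centered u|).
Proof.
rewrite /centered; case: ifP => // _.
have up : (u < p)%N by rewrite -[X in (_ < X)%N]Fp_cast.
have -> : angle `|u%:Z - p%:Z| = pi *+ 2 - angle u.
  rewrite (_ : `|_|%N = p - u)%N; last by lia.
  by rewrite /angle natrB ?(ltnW up) // mulrBr mulrBl mulfK.
by rewrite cosB cos2pi sin2pi mul1r mul0r addr0.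
Qed.

Lemma sin_natmul_le (k : nat) (x : R) : `|sin (k%:R * x)| <= k%:R * `|sin x|.
Proof.
elim: k => [|k IH]; first by rewrite !mul0r sin0 normr0.
rewrite -addn1 natrD !mulrDl !mul1r sinD (le_trans (ler_normD _ _)) // !normrM.
apply: lerD; first by rewrite (le_trans _ IH) // ler_piMr // cos_max.
by rewrite ler_piMl // cos_max.
Qed.

Lemma one_sub_cos (x : R) : 1 - cos x = 2 * sin (x / 2) ^+ 2.
Proof.
by rewrite {1}(splitr x) -mulr2n cos_mulr2n sin2cos2 !mulr2n; ring.
Qed.

(** Since 1 - cos x = 2 sin^2 (x/2), this is the square of the inequality
|sin k x| <= k |sin x|. *)
Lemma one_sub_cos_natmul (k : nat) (x : R) :
  1 - cos (k%:R * x) <= k%:R ^+ 2 * (1 - cos x).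
Proof.
have := sin_natmul_le k (x / 2); rewrite -mulrA => h.
have : `|sin (k%:R * (x / 2))| ^+ 2 <= (k%:R * `|sin (x / 2)|) ^+ 2.
  by rewrite lerXn2r // nnegrE // mulr_ge0.
by rewrite exprMn !real_normK ?num_real // !one_sub_cos -mulrA; nra.
Qed.

(** Some multiple k u with 2k <= M has a nonpositive cosine, and passing from u to
k u multiplies 1 - cos by at most k^2. *)
Lemma fcos_gap (u : 'F_p) (M : nat) : (p <= M * `|centered u|)%N ->
  4 <= M%:R ^+ 2 * (1 - fcos u).
Proof.
rewrite fcos_centered; set r := `|_|%N => pM.
have rp : (2 * r <= p)%N.
  have up : (u < p)%N by rewrite -[X in (_ < X)%N]Fp_cast.
  by rewrite /r /centered; case: ifP => //; lia.
have r0 : (0 < r)%N by have := prime_gt0 pp; case: r pM {rp} => //; lia.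
(* The multiple k * r lands in [p/4, p/2], where the cosine is nonpositive. *)
pose k := (p %/ (2 * r))%N.
have k0 : (0 < k)%N by rewrite divn_gt0 // muln_gt0.
have kr : (k * (2 * r) <= p)%N by rewrite leq_trunc_div.
have kr' : (p <= 2 * (k * (2 * r)))%N.
  by have := ltn_ceil p (_ : 0 < 2 * r)%N; rewrite -/k mulSn; nia.
have kM : (2 * k <= M)%N.
  by rewrite -(leq_pmul2r r0) (leq_trans _ pM) // -mulnA mulnCA.
have akE : k%:R * angle r = angle (k * r) by rewrite /angle natrM; ring.
have : cos (angle (k * r)) <= 0.
  have pp0 : 0 < p%:R :> R by rewrite ltr0n prime_gt0.
  have h1 : p%:R <= 4 * (k * r)%:R :> R by rewrite -natrM ler_nat; lia.
  have h2 : 2 * (k * r)%:R <= p%:R :> R by rewrite -natrM ler_nat; lia.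
  have pi0 := pi_gt0 R.
  have -> : cos (angle (k * r)) = - cos (pi - angle (k * r)).
    by rewrite cosB cospi sinpi mul0r addr0 mulN1r opprK.
  rewrite oppr_le0 cos_ge0_pihalf // /angle.
  have -> : pi *+ 2 * (k * r)%:R / p%:R = pi * (2 * (k * r)%:R / p%:R) :> R.
    by ring.
  set t := 2 * _ / _.
  have t1 : t <= 1 by rewrite /t ler_pdivrMr // mul1r.
  have t2 : 1 / 2 <= t by rewrite /t ler_pdivlMr //; lra.
  by apply/andP; split; nra.
have := one_sub_cos_natmul k (angle r); rewrite akE.
have := cos_le1 (angle r).
set C := cos (angle r); set C' := cos _ => C1 h1 h2.
have : (2 * k%:R) ^+ 2 <= M%:R ^+ 2 :> R.
  by rewrite lerXn2r ?nnegrE ?mulr_ge0 // -natrM ler_nat.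
by rewrite exprMn; nra.
Qed.

Lemma sum_shift (V : nmodType) (z : 'F_p) (f : 'F_p -> V) :
  \sum_y f (y + z) = \sum_y f y.
Proof.
by rewrite [RHS](reindex_inj (addIr z)).
Qed.

(** Shifting the variable by 1 rotates the vector of the two sums by the angle
2 pi / p, which fixes no vector but 0. *)
Lemma sum_fcos : \sum_u fcos u = 0.
Proof.
set Z := LHS; pose W := \sum_u fsin u.
have ZE : Z = fcos 1 * Z - fsin 1 * W.
  rewrite /Z /W -{1}(sum_shift 1) !mulr_sumr -sumrB; apply: eq_bigr => u _.
  by rewrite fcosD; ring.
have WE : W = fsin 1 * Z + fcos 1 * W.
  rewrite /Z /W -{1}(sum_shift 1) !mulr_sumr -big_split /=; apply: eq_bigr => u _.
  by rewrite fsinD; ring.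
have c1 : fcos 1 != 1.
  have cen : (0 < `|centered (1%R : 'F_p)|)%N.
    rewrite absz_gt0; apply/eqP => c0; have := centeredE (1 : 'F_p) pp.
    by rewrite c0 => /esym/eqP; rewrite oner_eq0.
  have := @fcos_gap (1 : 'F_p) p (leq_pmulr _ cen); apply: contraTneq => ->.
  by rewrite subrr mulr0 -ltNge.
have : (1 - fcos 1) ^+ 2 * Z = - (fsin 1) ^+ 2 * Z.
  have E1 : (1 - fcos 1) * Z = - fsin 1 * W by lra.
  have E2 : (1 - fcos 1) * W = fsin 1 * Z by lra.
  by rewrite expr2 -mulrA E1 mulrCA E2; ring.
have := fcos2Dfsin2 1 => E h.
have : (2 - 2 * fcos 1) * Z = 0 by nra.
by move/eqP; rewrite mulf_eq0 => /orP[|/eqP//]; move/eqP => h2; case/eqP: c1; lra.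
Qed.

Lemma sum_fcosM (z : 'F_p) : \sum_xi fcos (xi * z) = if z == 0 then p%:R else 0.
Proof.
case: eqP => [->|/eqP z0].
  under eq_bigr do rewrite mulr0 fcos0.
  by rewrite sumr_const card_Fp.
by rewrite -[RHS]sum_fcos [RHS](reindex_inj (mulIf z0)).
Qed.

Definition energy (g : 'F_p -> R) : R := \sum_y g y ^+ 2.

(** The squared modulus of the Fourier transform of G at xi. *)
Definition power (G : 'F_p -> R) (xi : 'F_p) : R :=
  \sum_y \sum_y' G y * G y' * fcos (xi * (y - y')).

Definition autocor (G : 'F_p -> R) (z : 'F_p) : R := \sum_y G y * G (y + z).

Lemma power_ge0 G xi : 0 <= power G xi.
Proof.
suff -> : power G xi =
    (\sum_y G y * fcos (xi * y)) ^+ 2 + (\sum_y G y * fsin (xi * y)) ^+ 2.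
  by rewrite addr_ge0 ?sqr_ge0.
rewrite !expr2 !mulr_suml -big_split; apply: eq_bigr => y _ /=.
rewrite !mulr_sumr -big_split; apply: eq_bigr => y' _ /=.
by rewrite mulrBr fcosB; ring.
Qed.

Lemma power0 G : power G 0 = (\sum_y G y) ^+ 2.
Proof.
rewrite expr2 mulr_suml; apply: eq_bigr => y _; rewrite mulr_sumr.
by apply: eq_bigr => y' _; rewrite mul0r fcos0 mulr1.
Qed.

Lemma power_inversion G z :
  \sum_xi power G xi * fcos (xi * z) = p%:R * autocor G z.
Proof.
have fcosM u v : fcos u * fcos v = (fcos (u + v) + fcos (u - v)) / 2.
  by rewrite fcosD fcosB; lra.
have selD : \sum_y \sum_y' G y * G y' * (if y - y' + z == 0 then p%:R else 0)
    = p%:R * autocor G z.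
  rewrite mulr_sumr; apply: eq_bigr => y _.
  rewrite (bigD1 (y + z)) //= big1 ?addr0 => [|y' y'z].
    by rewrite opprD addrA subrr sub0r addNr eqxx; ring.
  rewrite ifN ?mulr0 //; apply: contra_neq y'z => E.
  by apply/eqP; rewrite -subr_eq0 -oppr_eq0 -E; apply/eqP; ring.
have selB : \sum_y \sum_y' G y * G y' * (if y - y' - z == 0 then p%:R else 0)
    = p%:R * autocor G z.
  rewrite exchange_big /= mulr_sumr; apply: eq_bigr => y _.
  rewrite (bigD1 (y + z)) //= big1 ?addr0 => [|y' y'z].
    by rewrite addrAC addrK subrr eqxx; ring.
  rewrite ifN ?mulr0 //; apply: contra_neq y'z => E.
  by apply/eqP; rewrite -subr_eq0 -E; apply/eqP; ring.
transitivity ((p%:R * autocor G z + p%:R * autocor G z) / 2); last by lra.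
rewrite -{1}selD -selB -big_split mulr_suml /=.
under eq_bigr => xi _ do rewrite mulr_suml.
rewrite exchange_big; apply: eq_bigr => y _ /=.
under eq_bigr => xi _ do rewrite mulr_suml.
rewrite exchange_big -big_split mulr_suml; apply: eq_bigr => y' _ /=.
rewrite -!sum_fcosM -mulrDr -mulrA -big_split mulr_suml mulr_sumr.
by apply: eq_bigr => xi _ /=; rewrite -mulrA fcosM !mulrDr !mulrN.
Qed.

Lemma energy_shift G z :
  energy (fun y => G (y + z) - G y) = 2 * (autocor G 0 - autocor G z).
Proof.
have E0 : autocor G 0 = energy G.
  by apply: eq_bigr => y _; rewrite addr0 expr2.
have -> : energy (fun y => G (y + z) - G y) =
    energy (fun y => G (y + z)) + energy G - 2 * autocor G z.
  rewrite /energy -big_split mulr_sumr -sumrB; apply: eq_bigr => y _ /=; ring.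
by rewrite {1}/energy (sum_shift z (fun y => G y ^+ 2)) -/(energy G) E0; ring.
Qed.

(** On the Fourier side the translation by w multiplies the frequency xi by a
unit complex number whose distance to 1 is measured by 1 - cos (2 pi xi w / p).  The
frequency 0 carries nothing because G has sum zero, and each of the other ones
is detected by some w_j. *)
Lemma poincare_translations (G : 'F_p -> R) (n M : nat) (w : nat -> 'F_p) :
  \sum_y G y = 0 ->
  (forall xi, xi != 0 -> exists2 j, (j < n)%N & (p <= M * `|centered (xi * w j)%R|)%N) ->
  energy G <= M%:R ^+ 2 / 8 *
    \sum_(j < n) energy (fun y => G (y + w j) - G y).
Proof.
move=> G0 esc.
have pp0 : 0 < p%:R :> R by rewrite ltr0n prime_gt0.
have gap xi : xi != 0 -> 4 <= M%:R ^+ 2 * \sum_(j < n) (1 - fcos (xi * w j)).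
  move=> /esc[j jn /fcos_gap h]; apply: le_trans h _.
  rewrite ler_wpM2l ?sqr_ge0 // (bigD1 (Ordinal jn)) //= lerDl sumr_ge0 // => i _.
  by rewrite subr_ge0 cos_le1.
have pE : p%:R * energy G = \sum_xi power G xi.
  have -> : energy G = autocor G 0 by apply: eq_bigr => y _; rewrite addr0 expr2.
  by rewrite -power_inversion; apply: eq_bigr => xi _; rewrite mulr0 fcos0 mulr1.
have pEj j : p%:R / 2 * energy (fun y => G (y + w j) - G y) =
    \sum_xi power G xi * (1 - fcos (xi * w j)).
  rewrite energy_shift mulrA mulfVK ?pnatr_eq0 // mulrBr -!power_inversion -sumrB.
  by apply: eq_bigr => xi _; rewrite mulr0 fcos0; ring.
rewrite -(ler_pM2l pp0) pE.
have -> : p%:R * (M%:R ^+ 2 / 8 * \sum_(j < n) energy (fun y => G (y + w j) - G y))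
    = \sum_xi power G xi * (M%:R ^+ 2 * \sum_(j < n) (1 - fcos (xi * w j))) / 4.
  transitivity (M%:R ^+ 2 / 4 *
      \sum_(j < n) (p%:R / 2 * energy (fun y => G (y + w j) - G y))).
    by rewrite -mulr_sumr; field.
  under eq_bigr => j _ do rewrite pEj.
  rewrite exchange_big /= mulr_sumr; apply: eq_bigr => xi _.
  by rewrite -mulr_sumr; field.
apply: ler_sum => xi _; have [->|xi0] := eqVneq xi 0.
  by rewrite power0 G0 expr0n /= !mul0r.
by have := gap _ xi0; have := power_ge0 G xi; nra.
Qed.

End Characters.

(** * From almost invariance under the chain to almost invariance under translations *)

(** For a probability w this says that twice the variance is the mean square
difference of two independent copies; without this normalization it also contains
the inequality of Cauchy and Schwarz, for w = 1. *)
Lemma weighted_variance (R : realFieldType) (I : finType) (w a : I -> R) :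
  \sum_i \sum_j w i * w j * (a i - a j) ^+ 2 =
  2 * ((\sum_i w i) * (\sum_i w i * a i ^+ 2) - (\sum_i w i * a i) ^+ 2).
Proof.
set W := \sum_i w i; set A2 := \sum_i w i * _; set A1 := \sum_i w i * a i.
have inner i : \sum_j w i * w j * (a i - a j) ^+ 2 =
    w i * a i ^+ 2 * W + w i * A2 - 2 * (w i * a i) * A1.
  rewrite !mulr_sumr -big_split -sumrB; apply: eq_bigr => j _ /=; ring.
under eq_bigr => i _ do rewrite inner.
rewrite sumrB big_split /= -!mulr_suml -mulr_sumr -/W -/A2 -/A1; ring.
Qed.

Lemma sqr_sum_le (R : realFieldType) (I : finType) (a : I -> R) :
  (\sum_i a i) ^+ 2 <= #|I|%:R * \sum_i a i ^+ 2.
Proof.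
have := weighted_variance (fun=> 1) a.
under eq_bigr do under eq_bigr do rewrite !mul1r.
under [X in _ = _ * (_ * X - _)]eq_bigr do rewrite mul1r.
under [X in _ = _ * (_ - X ^+ 2)]eq_bigr do rewrite mul1r.
rewrite sumr_const => E; rewrite -subr_ge0 -(pmulr_rge0 _ (ltr0Sn R 1)) -E.
by apply: sumr_ge0 => i _; apply: sumr_ge0 => j _; apply: sqr_ge0.
Qed.

Section Energy.
Variables (R : realType) (p : nat).
Implicit Types (u v g G : 'F_p -> R) (theta : 'F_p).

Lemma energy_ge0 u : 0 <= energy u.
Proof. by apply: sumr_ge0 => y _; apply: sqr_ge0. Qed.

Lemma energy_comp u (s : 'F_p -> 'F_p) : injective s ->
  energy (fun y => u (s y)) = energy u.
Proof. by move=> si; rewrite /energy [RHS](reindex_inj si). Qed.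

Lemma energyD_le u v : energy (fun y => u y + v y) <= 2 * (energy u + energy v).
Proof.
rewrite /energy -big_split mulr_sumr; apply: ler_sum => y _ /=.
by have := sqr_ge0 (u y - v y); nra.
Qed.

Lemma energy_sum_le n (u : 'I_n -> 'F_p -> R) :
  energy (fun y => \sum_i u i y) <= n%:R * \sum_i energy (u i).
Proof.
rewrite /energy exchange_big mulr_sumr; apply: ler_sum => y _ /=.
by have := sqr_sum_le (fun i => u i y); rewrite card_ord.
Qed.

(** Telescoping: the j increments between consecutive powers of theta all have the
same energy, and the squared sum of j terms costs a factor j. *)
Lemma energy_dilation_iter G theta (delta : R) (j : nat) : theta != 0 ->
  energy (fun y => G (theta * y) - G y) <= delta ->
  energy (fun y => G (theta ^+ j * y) - G y) <= j%:R ^+ 2 * delta.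
Proof.
move=> t0 Ed.
have -> : (fun y => G (theta ^+ j * y) - G y) =
    (fun y => \sum_(i < j) (G (theta ^+ i.+1 * y) - G (theta ^+ i * y))).
  apply/funext => y; rewrite -(big_mkord xpredT (fun i =>
    G (theta ^+ i.+1 * y) - G (theta ^+ i * y))).
  by rewrite telescope_sumr // expr0 mul1r.
apply: le_trans (energy_sum_le _) _.
rewrite expr2 -mulrA ler_wpM2l //.
have -> : j%:R * delta = \sum_(i < j) delta.
  by rewrite sumr_const card_ord mulr_natl.
apply: ler_sum => i _; apply: le_trans Ed.
under eq_fun => y do rewrite exprS -mulrA.
rewrite (energy_comp (fun y => G (theta * y) - G y)) //.
by apply: mulfI; rewrite expf_neq0.
Qed.

(** The map y |-> 1 - theta (1 - y) composed with the division by theta is the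
translation by 1 - theta. *)
Lemma energy_translation G theta (delta : R) : theta != 0 ->
  energy (fun y => G (theta * y) - G y) <= delta ->
  energy (fun y => G (1 - theta * (1 - y)) - G y) <= delta ->
  energy (fun y => G (y + (1 - theta)) - G y) <= 4 * delta.
Proof.
move=> t0 E1 E2.
have V0 : theta^-1 != 0 by rewrite invr_eq0.
have := energyD_le
  (fun y => G (1 - theta * (1 - theta^-1 * y)) - G (theta^-1 * y))
  (fun y => G (theta^-1 * y) - G y).
rewrite (energy_comp (fun y => G (1 - theta * (1 - y)) - G y) (mulfI V0)).
have -> : energy (fun y => G (theta^-1 * y) - G y) =
    energy (fun y => G (theta * y) - G y).
  rewrite -(energy_comp _ (mulfI t0)); apply: eq_bigr => y _.
  by rewrite mulKf //; ring.
have -> : (fun y => G (1 - theta * (1 - theta^-1 * y)) - G (theta^-1 * y) +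
    (G (theta^-1 * y) - G y)) = (fun y => G (y + (1 - theta)) - G y).
  apply/funext => y; rewrite mulrBr mulr1 mulVKf //.
  by rewrite (_ : 1 - (theta - y) = y + (1 - theta)); ring.
by lra.
Qed.

(** The translation by b theta^j is the translation by b conjugated by theta^j, so
three successive comparisons bound its energy. *)
Lemma affine_gap G theta (delta : R) (n M : nat) : prime p ->
  theta != 0 -> theta != 1 ->
  (forall z, z != 0 ->
    exists2 j, (j < n)%N & (p <= M * `|centered (z * theta ^+ j)%R|)%N) ->
  \sum_y G y = 0 -> 0 <= delta ->
  energy (fun y => G (theta * y) - G y) <= delta ->
  energy (fun y => G (1 - theta * (1 - y)) - G y) <= delta ->
  energy G <= M%:R ^+ 2 * n%:R * (n%:R ^+ 2 + 2) * delta.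
Proof.
move=> pp t0 t1 esc G0 d0 E1 E2; set b := 1 - theta.
have b0 : b != 0 by rewrite subr_eq0 eq_sym.
have esc' z : z != 0 ->
    exists2 j, (j < n)%N & (p <= M * `|centered (z * (b * theta ^+ j))%R|)%N.
  by move=> z0; rewrite -/b; have [|j jn pj] := esc (z * b);
    rewrite ?mulf_neq0 //; exists j; rewrite // mulrA.
apply: le_trans (poincare_translations pp G0 esc') _.
have Ej (j : 'I_n) : energy (fun y => G (y + b * theta ^+ j) - G y) <=
    (6 * n%:R ^+ 2 + 12) * delta.
  have tj0 : theta ^+ j != 0 by rewrite expf_neq0.
  have Dj := energy_dilation_iter j t0 E1.
  rewrite -(energy_comp _ (mulfI tj0)).
  pose u y := G (theta ^+ j * (y + b)) - G (y + b).
  pose v y := G (y + b) - G y.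
  pose w y := G y - G (theta ^+ j * y).
  have -> : (fun y => G (theta ^+ j * y + b * theta ^+ j) - G (theta ^+ j * y)) =
      (fun y => u y + v y + w y).
    apply/funext => y; rewrite /u /v /w.
    by rewrite (_ : theta ^+ j * (y + b) = theta ^+ j * y + b * theta ^+ j); ring.
  have u_le : energy u <= j%:R ^+ 2 * delta.
    by rewrite /u (energy_comp (fun y => G (theta ^+ j * y) - G y) (addIr b)).
  have w_le : energy w <= j%:R ^+ 2 * delta.
    apply: le_trans Dj; rewrite le_eqVlt; apply/orP; left; apply/eqP.
    by apply: eq_bigr => y _; rewrite /w; ring.
  have v_le : energy v <= 4 * delta := energy_translation t0 E1 E2.
  have uvw : energy (fun y => u y + v y + w y) <=
      3 * (energy u + energy v + energy w).
    rewrite /energy -!big_split mulr_sumr; apply: ler_sum => y _ /=.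
    have := sqr_ge0 (u y - v y); have := sqr_ge0 (u y - w y).
    by have := sqr_ge0 (v y - w y); nra.
  have jn : j%:R ^+ 2 * delta <= n%:R ^+ 2 * delta.
    by rewrite ler_wpM2r // lerXn2r ?nnegrE // ler_nat ltnW.
  by lra.
have : \sum_(j < n) energy (fun y => G (y + b * theta ^+ j) - G y) <=
    n%:R * ((6 * n%:R ^+ 2 + 12) * delta).
  apply: le_trans (ler_sum _ (fun j _ => Ej j)) _.
  by rewrite sumr_const card_ord -[leLHS]mulr_natl.
set S := \sum_(j < n) _ => SE.
have M0 : 0 <= M%:R ^+ 2 / 8 :> R by rewrite divr_ge0 ?sqr_ge0.
apply: le_trans (ler_wpM2l M0 SE) _; rewrite -subr_ge0.
have -> : M%:R ^+ 2 * n%:R * (n%:R ^+ 2 + 2) * delta -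
    M%:R ^+ 2 / 8 * (n%:R * ((6 * n%:R ^+ 2 + 12) * delta)) =
    M%:R ^+ 2 * n%:R * (n%:R ^+ 2 + 2) * delta / 4 by field.
by rewrite !(mulr_ge0, addr_ge0, sqr_ge0, invr_ge0).
Qed.

Lemma fstar0 : fstar (0 : 'F_p) = 0.
Proof. by rewrite /fstar eq_sym oner_eq0 mul0r. Qed.

Lemma fstarV (y : 'F_p) : y != 0 -> y != 1 -> fstar y^-1 = (1 - y)^-1.
Proof.
move=> y0 y1; rewrite /fstar ifN; last by rewrite invr_eq1.
rewrite -invfM mulrBr divff // mulr1 //.
Qed.

Lemma fstar_invol (x : 'F_p) : fstar (fstar x) = x.
Proof.
have [->|x0] := eqVneq x 0; first by rewrite !fstar0.
have [->|x1] := eqVneq x 1; first by rewrite /fstar !eqxx.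
have y0 : x^-1 != 0 by rewrite invr_eq0.
have y1 : x^-1 != 1 by rewrite invr_eq1.
have z0 : 1 - x^-1 != 0 by rewrite subr_eq0 eq_sym.
have z1 : 1 - x^-1 != 1 by rewrite -subr_eq0 addrAC subrr sub0r oppr_eq0.
by rewrite -[X in fstar (fstar X)]invrK fstarV // fstarV // opprB addrC subrK invrK.
Qed.

Lemma fstar_inj : injective (@fstar p).
Proof. exact: can_inj fstar_invol. Qed.

(** The change of variables under which skipping the state 0 becomes harmless: the
reflection y |-> 1 - theta (1 - y) fixes 1 and moves 0, whereas f_* o (division by
theta) o f_* moves 1 and fixes 0. *)
Definition inversion_swap (y : 'F_p) : 'F_p :=
  if y == 0 then 1 else if y == 1 then 0 else y^-1.

Lemma inversion_swap_inj : injective inversion_swap.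
Proof.
apply: (can_inj (g := inversion_swap)) => y; rewrite /inversion_swap.
have [->|y0] := eqVneq y 0; first by rewrite oner_eq0 eqxx.
have [->|y1] := eqVneq y 1; first by rewrite eqxx.
by rewrite invr_eq0 (negPf y0) invr_eq1 (negPf y1) invrK.
Qed.

(** The function y |-> g (1/y), extended to 0 by its value at 1, the state from which
the reflection y |-> 1 - y enters 0 and to which it returns. *)
Definition reciprocal g (y : 'F_p) : R := if y == 0 then g 1 else g y^-1.

Lemma reciprocal_dilation g theta : theta != 0 ->
  energy (fun y => reciprocal g (theta * y) - reciprocal g y) =
  energy (fun x => g (x / theta) - g x).
Proof.
move=> t0; rewrite -[RHS](energy_comp _ (@invr_inj _)); apply: eq_bigr => y _.
rewrite /reciprocal mulf_eq0 (negPf t0) /=; case: eqP => [->|_].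
  by rewrite invr0 mul0r !subrr.
by rewrite invfM mulrC.
Qed.

(** Away from 0 and 1 both sides agree at 1/y, even when the reflection sends y to
0: the chain is then sent to 1, where the extension takes the same value.  The
points 0 and 1 exchange their contributions. *)
Lemma reciprocal_reflection g theta : theta != 0 -> theta != 1 ->
  energy (fun y => reciprocal g (1 - theta * (1 - y)) - reciprocal g y) =
  energy (fun x => g (fstar (fstar x / theta)) - g x).
Proof.
move=> t0 t1; rewrite -[RHS](energy_comp _ inversion_swap_inj).
apply: eq_bigr => y _; congr (_ ^+ 2); rewrite /inversion_swap /reciprocal.
have [->|y0] := eqVneq y 0.
  rewrite subr0 mulr1 subr_eq0 eq_sym (negPf t1).
  by rewrite {2}/fstar eqxx mul1r fstarV.
have [->|y1] := eqVneq y 1.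
  by rewrite subrr mulr0 subr0 oner_eq0 invr1 fstar0 mul0r fstar0 !subrr.
have y1' : 1 - y != 0 by rewrite subr_eq0 eq_sym.
rewrite fstarV // -invfM [(1 - y) * _]mulrC; have [E|E] := eqVneq (1 - theta * (1 - y)) 0.
  by move/eqP: E; rewrite subr_eq0 => /eqP <-; rewrite invr1 /fstar eqxx.
by rewrite fstarV ?mulf_neq0 // -subr_eq0 -oppr_eq0 opprB.
Qed.

(** Subtracting its mean from the extension changes no variation, and the energy of
g around 0 is the least one around a constant because g has sum zero. *)
Lemma chain_gap g theta (delta : R) (n M : nat) : prime p ->
  theta != 0 -> theta != 1 ->
  (forall z, z != 0 ->
    exists2 j, (j < n)%N & (p <= M * `|centered (z * theta ^+ j)%R|)%N) ->
  g 0 = 0 -> \sum_x g x = 0 -> 0 <= delta ->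
  energy (fun x => g (x / theta) - g x) <= delta ->
  energy (fun x => g (fstar (fstar x / theta)) - g x) <= delta ->
  energy g <= M%:R ^+ 2 * n%:R * (n%:R ^+ 2 + 2) * delta.
Proof.
move=> pp t0 t1 esc g0 gS d0.
rewrite -reciprocal_dilation // -reciprocal_reflection // => E1 E2.
pose m := (\sum_y reciprocal g y) / p%:R; pose G y := reciprocal g y - m.
have p0 : p%:R != 0 :> R by rewrite pnatr_eq0 -lt0n prime_gt0.
have GS : \sum_y G y = 0.
  rewrite /G sumrB sumr_const card_Fp // -mulr_natr /m mulfVK // subrr //.
have GB y z : G z - G y = reciprocal g z - reciprocal g y by rewrite /G; ring.
apply: (@le_trans _ _ (energy G)); last first.
  by apply: (affine_gap pp t0 t1 esc) => //; under eq_fun do rewrite GB.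
rewrite -(energy_comp g (@invr_inj _)) /energy (bigD1 0) //= invr0 g0 expr0n /= add0r.
rewrite [leRHS](bigD1 0) //=.
have gS' : \sum_(y | y != 0) g y^-1 = 0.
  by move: gS; rewrite (reindex_inj (@invr_inj _)) /= (bigD1 0) //= invr0 g0 add0r.
have -> : \sum_(y | y != 0) G y ^+ 2 =
    \sum_(y | y != 0) g y^-1 ^+ 2 - 2 * m * \sum_(y | y != 0) g y^-1 +
    \sum_(y : 'F_p | y != 0) m ^+ 2.
  rewrite mulr_sumr -sumrB -big_split; apply: eq_bigr => y y0 /=.
  by rewrite /G /reciprocal (negPf y0); ring.
rewrite gS' mulr0 subr0 addrCA lerDl addr_ge0 ?sqr_ge0 // sumr_ge0 // => y _.
exact: sqr_ge0.
Qed.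

End Energy.

(** * Loss of energy in one or two steps *)

(** The loss is the variance of i |-> g (s_i y) summed over y; of all pairs (i, j)
contributing to it only (a, b) is kept. *)
Lemma mixture_energy (R : realType) (p : nat) (I : finType) (w : I -> R)
    (s : I -> 'F_p -> 'F_p) (g : 'F_p -> R) (a b : I) :
  (forall i, 0 <= w i) -> \sum_i w i = 1 ->
  (forall i, w i != 0 -> injective (s i)) ->
  energy (fun y => \sum_i w i * g (s i y)) <=
  energy g - w a * w b / 2 * energy (fun y => g (s a y) - g (s b y)).
Proof.
move=> w0 w1 sinj.
have -> : energy g = \sum_y \sum_i w i * g (s i y) ^+ 2.
  rewrite exchange_big /= -[LHS]mul1r -w1 mulr_suml; apply: eq_bigr => i _.
  rewrite -mulr_sumr; have [->|/sinj si] := eqVneq (w i) 0; first by rewrite !mul0r.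
  by rewrite -(energy_comp g si).
rewrite {2}/energy mulr_sumr -sumrB; apply: ler_sum => y _.
have := weighted_variance w (fun i => g (s i y)); rewrite w1 mul1r.
have : w a * w b * (g (s a y) - g (s b y)) ^+ 2 <=
    \sum_i \sum_j w i * w j * (g (s i y) - g (s j y)) ^+ 2.
  have t0 i j : 0 <= w i * w j * (g (s i y) - g (s j y)) ^+ 2.
    by rewrite mulr_ge0 ?sqr_ge0 // mulr_ge0.
  rewrite (bigD1 a) //= (bigD1 b) //= -addrA lerDl addr_ge0 ?sumr_ge0 // => i _.
  by rewrite sumr_ge0.
by lra.
Qed.

Section Chains.
Variables (R : realType) (p : nat) (nu : 'F_p -> R).
Hypotheses (pp : prime p) (nu_ge0 : forall e, 0 <= nu e) (nu0 : nu 0 = 0).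
Hypothesis nu1 : \sum_e nu e = 1.
Implicit Types (g : 'F_p -> R) (gamma theta : 'F_p).

(** The evolution of a mass function under x |-> f_* (x) e with e distributed along
nu: as f_* is an involution, the only preimage of y is f_* (y/e). *)
Definition push g (y : 'F_p) : R := \sum_e nu e * g (fstar (y / e)).
Definition lazy_push g (y : 'F_p) : R := (g y + push g y) / 2.

Let step_inj e : nu e != 0 -> injective (fun y => fstar (y / e)).
Proof.
move=> ne; have e0 : e != 0 by apply: contra_neq ne => ->.
by move=> y z /fstar_inj /mulIf -> //; rewrite invr_eq0.
Qed.

Lemma push0 g : push g 0 = g 0.
Proof.
by rewrite /push; under eq_bigr => e _ do rewrite mul0r fstar0;
   rewrite -mulr_suml nu1 mul1r.
Qed.

Lemma sum_push g : \sum_y push g y = \sum_y g y.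
Proof.
rewrite exchange_big -[RHS]mul1r -nu1 mulr_suml; apply: eq_bigr => e _ /=.
rewrite -mulr_sumr; have [->|/step_inj si] := eqVneq (nu e) 0; first by rewrite !mul0r.
by rewrite [in RHS](reindex_inj si).
Qed.

Lemma push_energy_le g : energy (push g) <= energy g.
Proof.
apply: le_trans (mixture_energy g 0 0 nu_ge0 nu1 step_inj) _.
by rewrite gerBl mulr_ge0 ?energy_ge0 // divr_ge0 // mulr_ge0.
Qed.

Lemma lazy_push0 g : lazy_push g 0 = g 0.
Proof. by rewrite /lazy_push push0; lra. Qed.

Lemma sum_lazy_push g : \sum_y lazy_push g y = \sum_y g y.
Proof. by rewrite -mulr_suml big_split /= sum_push; lra. Qed.

Lemma lazy_push_drop g e : 1 / 2 <= nu e ->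
  energy (fun y => g (fstar (y / e)) - g y) <=
  16 * (energy g - energy (lazy_push g)).
Proof.
move=> e2.
pose w (o : option 'F_p) := if o is Some e then nu e / 2 else 1 / 2 : R.
pose s (o : option 'F_p) (y : 'F_p) := if o is Some e then fstar (y / e) else y.
have sum_opt (F : option 'F_p -> R) : \sum_o F o = F None + \sum_e F (Some e).
  rewrite (bigD1 None) //= (reindex_omap (Some : 'F_p -> _) id) => [|[]//].
  by congr (_ + _); apply: eq_bigl => e' /=; rewrite eqxx.
have w0 o : 0 <= w o by case: o => [e'|] //=; rewrite divr_ge0.
have w1 : \sum_o w o = 1 by rewrite sum_opt /= -mulr_suml nu1; lra.
have si o : w o != 0 -> injective (s o).
  case: o => [e'|_ y z //] /= ne; apply: step_inj; apply: contra_neq ne => ->.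
  by rewrite mul0r.
have := mixture_energy g (Some e) None w0 w1 si.
have -> : (fun y => \sum_o w o * g (s o y)) = lazy_push g.
  apply/funext => y; rewrite sum_opt /= /lazy_push /push mulrDl mulr_suml.
  by congr (_ + _); [lra|apply: eq_bigr => e' _; ring].
have := energy_ge0 (fun y => g (s (Some e) y) - g (s None y)).
by rewrite /=; set E := energy _; nra.
Qed.

(** Over two steps the pair of factors (1, 1) gives f_* o f_*, the identity map. *)
Lemma push2_drop g a b : 1 / 3 <= nu a -> 1 / 3 <= nu b -> 1 / 3 <= nu 1 ->
  energy (fun y => g (fstar (fstar (y / a) / b)) - g y) <=
  162 * (energy g - energy (push (push g))).
Proof.
move=> a3 b3 o3.
pose w (e : 'F_p * 'F_p) := nu e.1 * nu e.2.
pose s (e : 'F_p * 'F_p) (y : 'F_p) := fstar (fstar (y / e.1) / e.2).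
have w0 e : 0 <= w e by rewrite mulr_ge0.
have w1 : \sum_e w e = 1.
  rewrite /w -(pair_big xpredT xpredT (fun e e' => nu e * nu e')) /= -nu1.
  by apply: eq_bigr => e _; rewrite -mulr_sumr nu1 mulr1.
have si e : w e != 0 -> injective (s e).
  rewrite mulf_eq0 negb_or => /andP[/step_inj i1 /step_inj i2] y z.
  by move=> /i2 /i1.
have := mixture_energy g (a, b) (1, 1) w0 w1 si.
have -> : (fun y => \sum_e w e * g (s e y)) = push (push g).
  apply/funext => y; rewrite /push.
  rewrite -(pair_big xpredT xpredT (fun e e' =>
    nu e * nu e' * g (fstar (fstar (y / e) / e')))) /=.
  apply: eq_bigr => e _; rewrite mulr_sumr.
  by apply: eq_bigr => e' _; rewrite mulrA.
have -> : (fun y => g (s (a, b) y) - g (s (1, 1) y)) =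
    (fun y => g (fstar (fstar (y / a) / b)) - g y).
  by apply/funext => y; rewrite /s /= !divr1 fstar_invol.
have := energy_ge0 (fun y => g (fstar (fstar (y / a) / b)) - g y).
have : 1 / 81 <= w (a, b) * w (1, 1).
  rewrite /w /=; have : 1 / 9 <= nu a * nu b by nra.
  have : 1 / 9 <= nu 1 * nu 1 by nra.
  by move: (nu a * _) (nu 1 * _) => u v; nra.
by set E := energy _; nra.
Qed.

(** The constant of the gap inequality for n powers of theta whose orbits reach
the distance p/M from 0. *)
Definition gap_cost (n M : nat) : R := M%:R ^+ 2 * n%:R * (n%:R ^+ 2 + 2).

Definition escapes theta (n M : nat) : Prop := forall z, z != 0 ->
  exists2 j, (j < n)%N & (p <= M * `|centered (z * theta ^+ j)%R|)%N.

Lemma gap_cost_ge0 n M : 0 <= gap_cost n M.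
Proof. by rewrite /gap_cost !mulr_ge0 ?addr_ge0 ?sqr_ge0. Qed.

(** The factors (gamma, 1) and (1, gamma) give the two variations that the gap
inequality needs, with theta = gamma. *)
Lemma push2_decay g gamma n M : gamma != 0 -> gamma != 1 ->
  1 / 3 <= nu gamma -> 1 / 3 <= nu 1 -> escapes gamma n M ->
  g 0 = 0 -> \sum_x g x = 0 ->
  energy g <= gap_cost n M * (162 * (energy g - energy (push (push g)))).
Proof.
move=> c0 c1 cg cc esc g0 gS; rewrite mulrC [leRHS]mulrC.
have E1 := push2_drop g cg cc cc; have E2 := push2_drop g cc cg cc.
apply: (chain_gap pp c0 c1 esc) => //.
- by rewrite mulr_ge0 // subr_ge0 (le_trans (push_energy_le _)) ?push_energy_le.
- by apply: le_trans E1; under [in leRHS]eq_fun do rewrite divr1 fstar_invol.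
- by apply: le_trans E2; under [in leRHS]eq_fun do rewrite divr1.
Qed.

(** Without the factor 1 only f_* (x/gamma) and f_* (x gamma) are available.
Comparing g at these two points at suitable x eliminates one f_*, at the price of
replacing gamma by its square. *)
Lemma lazy_push_decay g gamma n M : gamma != 0 -> gamma ^+ 2 != 1 ->
  1 / 2 <= nu gamma -> 1 / 2 <= nu gamma^-1 -> escapes (gamma ^+ 2) n M ->
  g 0 = 0 -> \sum_x g x = 0 ->
  energy g <= gap_cost n M * (64 * (energy g - energy (lazy_push g))).
Proof.
move=> c0 c1 cg cV esc g0 gS.
have EA := lazy_push_drop g cg; have EB := lazy_push_drop g cV.
set drop := energy g - _ in EA EB *.
pose a y := g (fstar (y / gamma)) - g y.
pose b y := g (fstar (y / gamma^-1)) - g y.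
have t0 : gamma ^+ 2 != 0 by rewrite expf_neq0.
have bN : energy (fun y => - b y) = energy b.
  by apply: eq_bigr => y _; rewrite sqrrN.
have inj_div e : e != 0 -> injective (fun y : 'F_p => y / e).
  by move=> e0; apply: mulIf; rewrite invr_eq0.
have sq y : y / gamma ^+ 2 / gamma^-1 = y / gamma.
  by rewrite expr2 invfM invrK mulrA mulfVK.
have sq' y : y / gamma / gamma = y / gamma ^+ 2 by rewrite expr2 invfM mulrA.
have sq'' y : y / gamma / gamma^-1 = y by rewrite invrK mulfVK.
have drop0 : 0 <= drop by have := energy_ge0 a; rewrite /a; lra.
apply: (chain_gap pp t0 c1 esc) => //; first by rewrite mulr_ge0.
- have := energyD_le a (fun y => - b (y / gamma ^+ 2)).
  rewrite (energy_comp (fun y => - b y) (inj_div _ t0)) bN.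
  have -> : (fun y => a y + - b (y / gamma ^+ 2)) =
      (fun x => g (x / gamma ^+ 2) - g x).
    by apply/funext => y; rewrite /a /b sq; ring.
  by rewrite /a /b; lra.
- have := energyD_le (fun y => a (y / gamma)) (fun y => - b (y / gamma)).
  rewrite (energy_comp a (inj_div _ c0)) (energy_comp (fun y => - b y) (inj_div _ c0)) bN.
  have -> : energy (fun x => g (fstar (fstar x / gamma ^+ 2)) - g x) =
      energy (fun y => a (y / gamma) + - b (y / gamma)).
    rewrite -[RHS](energy_comp _ (@fstar_inj p)); apply: eq_bigr => y _.
    by rewrite /a /b sq' sq'' fstar_invol; congr (_ ^+ 2); ring.
  by rewrite /a /b; lra.
Qed.

End Chains.

(** For p = 3 one has gamma^2 = 1, so that the general argument is void; but then
f_* is the identity and a function of sum zero changes sign under gamma. *)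
Lemma lazy_push_decay3 (R : realType) (p : nat) (nu g : 'F_p -> R) (gamma : 'F_p) :
  p = 3%N ->
  (forall e, 0 <= nu e) -> nu 0 = 0 -> \sum_e nu e = 1 ->
  1 / 2 <= nu gamma -> gamma = -1 -> g 0 = 0 -> \sum_x g x = 0 ->
  energy g <= 4 * (energy g - energy (lazy_push nu g)).
Proof.
move=> p3; subst p; move=> n0 nu0 n1 cg gE g0 gS.
have F3 (x : 'F_3) : [\/ x = 0, x = 1 | x = -1].
  by case: x => [[|[|[|k]]] lt]; [apply: Or31|apply: Or32|apply: Or33|by []];
    exact: val_inj.
have g1 : g (-1) = - g 1.
  apply/eqP; rewrite -addr_eq0 addrC -gS (bigD1 0) //= g0 add0r (bigD1 1) //=.
  rewrite (bigD1 (-1)) //= big1 ?addr0 // => x /andP[/andP[x0 x1] x2].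
  by case: (F3 x) => E; rewrite E ?eqxx in x0 x1 x2.
have gN x : g (fstar (x / gamma)) = - g x.
  rewrite gE invrN1 mulrN1; case: (F3 x) => ->.
  - by rewrite oppr0 fstar0 g0 oppr0.
  - by rewrite -g1; congr (g _); apply/eqP; vm_compute.
  - by rewrite opprK [in RHS]g1 opprK; congr (g _); apply/eqP; vm_compute.
have := lazy_push_drop n0 nu0 n1 g cg.
under eq_fun do rewrite gN.
have -> : energy (fun y => - g y - g y) = 4 * energy g.
  by rewrite /energy mulr_sumr; apply: eq_bigr => y _; ring.
by have := energy_ge0 g; lra.
Qed.

(** * The law of a chain driven by independent variables *)

Section Law.
Context d (T : measurableType d) (R : realType) (P : probability T R).

Lemma total_probability (I : finType) (V : T -> I) (A : set T) :
  (forall i, measurable (A `&` V @^-1` [set i])) ->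
  measurable A /\ P A = (\sum_i P (A `&` V @^-1` [set i]))%E.
Proof.
move=> mA; pose F i := A `&` V @^-1` [set i].
have AE : A = \bigcup_(i in [set: I]) F i.
  by apply/seteqP; split=> [w Aw|w [i _ []//]]; exists (V w) => //; split.
have fin : finite_set [set: I] by exact: finite_finset.
split; first by rewrite AE; apply: fin_bigcup_measurable => // i _; exact: mA.
have tF : trivIset [set: I] F.
  apply/trivIsetP => i j _ _ ij; apply/seteqP; split => // w [[_ /= Vi] [_ /= Vj]].
  by case/eqP: ij; rewrite -Vi -Vj.
rewrite {1}AE measure_fin_bigcup //; last by move=> i _; exact: mA.
have -> : [set: I] = [set` index_enum I].
  by apply/seteqP; split=> i _ //=; rewrite mem_index_enum.
by rewrite -fsbig_seq // index_enum_uniq.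
Qed.

Section Driven.
Variables (E S : finType) (Z : nat -> T -> E) (nu : E -> R).
Variables (step : E -> S -> S) (x0 : S) (X : nat -> T -> S).
Hypothesis X0 : forall w, X 0 w = x0.
Hypothesis XS : forall n w, X n.+1 w = step (Z n w) (X n w).

Definition cylinder (m N : nat) (e : nat -> E) : set T :=
  [set w | forall j, (m <= j < N)%N -> Z j w = e j].

Hypothesis cyl : forall N e, measurable (cylinder 0 N e) /\
  P (cylinder 0 N e) = (\prod_(0 <= j < N) nu (e j))%:E.

Fixpoint law (n : nat) (y : S) : R :=
  if n is m.+1 then \sum_e nu e * \sum_x (step e x == y)%:R * law m x
  else (x0 == y)%:R.

(** Induction on m: conditioning on the m-th variable and on the state at time m
keeps the event of the same form, with one more variable prescribed. *)
Lemma law_cylinder N m e y : (m <= N)%N ->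
  measurable (X m @^-1` [set y] `&` cylinder m N e) /\
  P (X m @^-1` [set y] `&` cylinder m N e) =
    (law m y * \prod_(m <= j < N) nu (e j))%:E.
Proof.
elim: m e y => [|m IH] e y mN.
  have [xy|xy] := eqVneq x0 y.
    have -> : X 0 @^-1` [set y] = setT by apply/seteqP; split=> w //= _; rewrite X0.
    by rewrite setTI /= xy eqxx mul1r; apply: cyl.
  have -> : X 0 @^-1` [set y] = set0.
    by apply/seteqP; split=> w //= /eqP; rewrite X0 (negPf xy).
  by rewrite set0I measure0 /= (negPf xy) mul0r.
pose V w := (Z m w, X m w).
pose A := X m.+1 @^-1` [set y] `&` cylinder m.+1 N e.
pose e' a j := if j == m then a else e j.
have AV (ax : E * S) : A `&` V @^-1` [set ax] =
    if step ax.1 ax.2 == y then X m @^-1` [set ax.2] `&` cylinder m N (e' ax.1)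
    else set0.
  case: ax => a x /=; apply/seteqP; split=> w /=.
    case=> -[Xy Zw] [Za Xx]; have -> : step a x = y by rewrite -Xy XS Za Xx.
    rewrite eqxx; split => // j.
    rewrite /e' leq_eqVlt andb_orl => /orP[/andP[/eqP<-] _|mj].
      by rewrite eqxx Za.
    by rewrite ifN ?Zw // eq_sym neq_ltn (andP mj).1.
  case: eqP => // sy [Xx Zw].
  have Za : Z m w = a by rewrite Zw ?leqnn ?mN // /e' eqxx.
  split; last by rewrite /V Za Xx.
  split=> [|j /andP[mj jN]]; first by rewrite /= XS Za Xx.
  by rewrite Zw ?(ltnW mj) ?jN // /e' ifN // eq_sym neq_ltn mj.
have IHa a x := IH (e' a) x (ltnW mN).
have mA ax : measurable (A `&` V @^-1` [set ax]).
  by rewrite AV; case: ifP => // _; case: (IHa ax.1 ax.2).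
have [mA' PA] := total_probability mA; split => //.
rewrite PA.
transitivity (\sum_(ax : E * S) (nu ax.1 * ((step ax.1 ax.2 == y)%:R * law m ax.2) *
    \prod_(m.+1 <= j < N) nu (e j))%:E)%E.
  apply: eq_bigr => -[a x] _; rewrite AV /=; case: eqP => _; last first.
    by rewrite measure0 mul0r mulr0 mul0r.
  have [_ ->] := IHa a x; congr _%:E.
  rewrite big_ltn // /e' eqxx mul1r mulrCA -mulrA; congr (_ * (_ * _)).
  by apply: eq_big_nat => j /andP[mj _]; rewrite ifN // eq_sym neq_ltn mj.
rewrite sumEFin -mulr_suml; congr (_ * _)%:E.
rewrite -(pair_big xpredT xpredT (fun a x =>
  nu a * ((step a x == y)%:R * law m x))) /=.
by apply: eq_bigr => a _; rewrite mulr_sumr.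
Qed.

Lemma driven_law n (A : {set S}) : measurable [set w | X n w \in A] /\
  P [set w | X n w \in A] = (\sum_(y in A) law n y)%:E.
Proof.
have H y : measurable (X n @^-1` [set y]) /\ P (X n @^-1` [set y]) = (law n y)%:E.
  (* A sequence of values, needed to speak of a cylinder, is read off a point of
     the space, which is not empty because it has mass 1. *)
  have [w0|noT] := pselect (exists w : T, True); last first.
    have T0 : (setT : set T) = set0.
      by apply/seteqP; split=> w // _; apply: noT; exists w.
    have := @probability_setT _ _ _ P; rewrite T0 measure0 => /eqP.
    by rewrite eqe eq_sym oner_eq0.
  case: w0 => w0 _.
  have := law_cylinder (fun j => Z j w0) y (leqnn n).
  rewrite big_geq // mulr1 (_ : cylinder n n _ = setT) ?setIT //.
  by apply/seteqP; split=> w // _ j /andP[/leq_ltn_trans h /h]; rewrite ltnn.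
have AV y : [set w | X n w \in A] `&` X n @^-1` [set y] =
    if y \in A then X n @^-1` [set y] else set0.
  apply/seteqP; split=> w /=; first by case=> wA Xy; rewrite -Xy wA.
  by case: ifP => // yA ->.
have mA y : measurable ([set w | X n w \in A] `&` X n @^-1` [set y]).
  by rewrite AV; case: ifP => // _; case: (H y).
have [mX ->] := total_probability mA; split => //.
rewrite -sumEFin [RHS]big_mkcond; apply: eq_bigr => y _; rewrite AV.
by case: ifP => _; [case: (H y)|rewrite measure0].
Qed.

End Driven.

Definition uniform_weight (E : finType) (S : {set E}) (x : E) : R :=
  if x \in S then #|S|%:R^-1 else 0.

Lemma discrete_sigma (E : Type) (Z : T -> E) (B : set E) :
  sigma_of Z (Z @^-1` B).
Proof. by exists B; rewrite ?setTI. Qed.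

Lemma cylinder_independent (E : finType) (S : {set E}) (Z : nat -> T -> E) :
  (forall j, discrete_rv (Z j)) -> (forall j, uniform_on P S (Z j)) ->
  independent_rvs P Z ->
  forall N e, measurable (cylinder Z 0 N e) /\
    P (cylinder Z 0 N e) = (\prod_(0 <= j < N) uniform_weight S (e j))%:E.
Proof.
move=> mZ uZ iZ N e.
have -> : cylinder Z 0 N e = \bigcap_(j in [set` index_iota 0 N]) (Z j @^-1` [set e j]).
  by apply/seteqP; split=> w /= h j; have := h j; rewrite /= mem_index_iota.
split.
  by rewrite bigcap_seq; apply: bigsetI_measurable => j _; apply: mZ.
rewrite iZ ?iota_uniq // => [|j _]; last exact: discrete_sigma.
by rewrite -prodEFin; apply: eq_bigr => j _; rewrite uZ.
Qed.

Lemma cylinder_independent2 (E1 E2 : finType) (S1 : {set E1}) (S2 : {set E2})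
    (Z : nat -> T -> E1) (W : nat -> T -> E2) :
  (forall j, discrete_rv (Z j)) -> (forall j, discrete_rv (W j)) ->
  (forall j, uniform_on P S1 (Z j)) -> (forall j, uniform_on P S2 (W j)) ->
  independent_rvs2 P Z W ->
  forall N e, measurable (cylinder (fun j w => (Z j w, W j w)) 0 N e) /\
    P (cylinder (fun j w => (Z j w, W j w)) 0 N e) =
    (\prod_(0 <= j < N) (uniform_weight S1 (e j).1 * uniform_weight S2 (e j).2))%:E.
Proof.
move=> mZ mW uZ uW iZW N e.
pose J := map inl (index_iota 0 N) ++ map inr (index_iota 0 N) : seq (nat + nat).
pose B (k : nat + nat) := match k with
  | inl j => Z j @^-1` [set (e j).1] | inr j => W j @^-1` [set (e j).2] end.
have -> : cylinder (fun j w => (Z j w, W j w)) 0 N e = \bigcap_(k in [set` J]) B k.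
  apply/seteqP; split=> w /= h.
    move=> k /=; rewrite mem_cat => /orP[] /mapP[j]; rewrite mem_index_iota => /h E ->.
      by rewrite /B /= -E.
    by rewrite /B /= -E.
  move=> j jN; rewrite [e j]surjective_pairing; congr (_, _).
    by apply: (h (inl j)); rewrite /= mem_cat map_f // mem_index_iota.
  by apply: (h (inr j)); rewrite /= mem_cat map_f ?orbT // mem_index_iota.
split.
  by rewrite bigcap_seq; apply: bigsetI_measurable => -[j|j] _; [apply: mZ|apply: mW].
rewrite iZW.
- rewrite big_cat !big_map big_split EFinM -!prodEFin /=.
  by congr (_ * _)%E; apply: eq_bigr => j _; rewrite ?uZ ?uW.
- rewrite cat_uniq !map_inj_uniq ?iota_uniq ?andbT //=; try by move=> ? ? [].
  by apply/hasPn => k /mapP[j _ ->]; apply/mapP => -[].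
- by case=> j _; apply: discrete_sigma.
Qed.

End Law.

(** * Size of the parameters *)

Lemma trivial_escape (p : nat) (theta : 'F_p) : prime p -> escapes theta 1 p.
Proof.
move=> pp z z0; exists 0%N => //; rewrite expr0 mulr1 leq_pmulr // absz_gt0.
by apply: contra_neq z0 => c0; rewrite -(centeredE z pp) c0.
Qed.

Lemma escapes_of_inj (p D H s : nat) (theta : 'F_p) : prime p -> (0 < D)%N ->
  (p < H.+1 ^ D.+1)%N -> (p <= 2 ^ s)%N ->
  {in gtn ((4 * D) ^ D).+1 &, injective (fun t => theta ^+ t)} ->
  escapes theta (D + s * (4 * D) ^ D) (D.+1 * H).
Proof.
move=> pp D0 pH ps inj z z0.
apply: (orbit_escapes pp D0 pH ps inj z0 erefl (y := fun j => centered (z * theta ^+ j))).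
by move=> j _; rewrite centeredE.
Qed.

Lemma cube_le_exp2 (m : nat) : (m ^ 3 + 2 * m ^ 2 + 16 * m <= 16 * (2 ^ m).+1)%N.
Proof.
elim: m => // m IH; have [m3|m3] := leqP 3 m; last first.
  by case: m m3 {IH} => [|[|[|]]].
rewrite [(2 ^ m.+1)%N]expnS; move: (2 ^ m)%N IH => k IH.
have -> : (m.+1 ^ 3 = m ^ 3 + 3 * m ^ 2 + 3 * m + 1)%N by ring.
have -> : (m.+1 ^ 2 = m ^ 2 + 2 * m + 1)%N by ring.
have q : (3 * m <= m ^ 2)%N by rewrite expnS expn1 leq_mul2r m3 orbT.
have c : (3 * m ^ 2 <= m ^ 3)%N by rewrite [leqRHS]expnS leq_mul2r m3 orbT.
by move: (m ^ 2)%N (m ^ 3)%N q c IH => u v; lia.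
Qed.

(** It bounds (4m)^m <= 2^(m (m + 2)) by a power of 2^(l/m) when m is close to
log2 l. *)
Lemma exponent_bound (l m : nat) : (0 < m)%N -> (2 ^ m <= l)%N ->
  (m * (m + 2) <= 16 * (l %/ m))%N.
Proof.
move=> m0 lm; have := ltn_ceil l m0; move: (l %/ m)%N => h lh.
rewrite leqNgt.
apply/negP => hm; have := cube_le_exp2 m.
have : (m * (16 * h + 1) <= m * (m * (m + 2)))%N by rewrite leq_mul2l addn1 hm orbT.
have -> : (m * (m * (m + 2)) = m ^ 3 + 2 * m ^ 2)%N by ring.
have -> : (m * (16 * h + 1) = 16 * (h * m) + m)%N by ring.
move: lh; rewrite mulSn; move: (h * m)%N (m ^ 3 + _)%N (2 ^ m)%N lm => u v w; lia.
Qed.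

(** With x = 2^h all factors are powers of x, and the product is at most x^179. *)
Lemma cost_bound (a h M n : nat) : (0 < h)%N -> (M <= 2 ^ (18 * h))%N ->
  (n <= 2 ^ (33 * h))%N -> (a <= 2 ^ (32 * h))%N ->
  (3 * a * (1 + 162 * (M ^ 2 * n * (n ^ 2 + 2))) <= 2 ^ (200 * h))%N.
Proof.
move=> h0 Mh nh ah.
have h1 : (2 ^ h >= 2)%N by rewrite -{1}(expn1 2) leq_exp2l.
rewrite !(mulnC _ h) !expnM in Mh nh ah *.
move: (2 ^ h)%N h1 Mh nh ah => x x2 Mx nx ax.
have x0 : (0 < x)%N by apply: leq_trans x2.
have const c k : (c <= 2 ^ k -> c <= x ^ k)%N.
  by case: k => // k ck; rewrite (leq_trans ck) // leq_exp2r.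

have sq u k : (u <= x ^ k -> u ^ 2 <= x ^ (2 * k))%N.
  by move=> uk; rewrite mulnC expnM leq_sqr.
have mul u v j k : (u <= x ^ j -> v <= x ^ k -> u * v <= x ^ (j + k))%N.
  by move=> uj vk; rewrite expnD leq_mul.
have add u v j k : (u <= x ^ j -> v <= x ^ k -> u + v <= x ^ (maxn j k).+1)%N.
  move=> uj vk; rewrite expnS (leq_trans (_ : _ <= 2 * x ^ maxn j k)%N) ?leq_mul //.
  by rewrite mul2n -addnn leq_add // (leq_trans uj _, leq_trans vk _) // leq_pexp2l
    ?leq_maxl ?leq_maxr.
have := mul _ _ _ _ (mul _ _ _ _ (const 3 2 isT) ax)
  (add _ _ _ _ (const 1 0 isT) (mul _ _ _ _ (const 162 8 isT)
    (mul _ _ _ _ (mul _ _ _ _ (sq _ _ Mx) nx)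
      (add _ _ _ _ (sq _ _ nx) (const 2 1 isT))))).
by move=> /leq_trans -> //; rewrite leq_pexp2l.
Qed.

(** An integer version of log p / log log p; the maximum with 1 accounts for
p = 3, where the inner logarithm vanishes. *)
Definition mixing_exponent (p : nat) : nat :=
  let l := trunc_log 2 p in maxn 1 (l %/ trunc_log 2 l).

Lemma prim_root_inj (p i : nat) (gamma : 'F_p) (T : nat) : (0 < i)%N ->
  (i * T < p.-1)%N -> (p.-1).-primitive_root gamma ->
  {in gtn T.+1 &, injective (fun t => (gamma ^+ i) ^+ t)}.
Proof.
move=> i0 iT prim t t'; rewrite !inE !ltnS => tT tT' /eqP.
rewrite -!exprM (eq_prim_root_expr prim) !modn_small.
- by rewrite eqn_pmul2l // => /eqP.
- by apply: leq_ltn_trans iT; rewrite leq_mul2l tT' orbT.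
- by apply: leq_ltn_trans iT; rewrite leq_mul2l tT orbT.
Qed.

(** With l = log2 p and m = log2 l, rounded down, the degree is m and the height
2^(l/m + 1).  If p <= 2 (4m)^m + 1, then the powers of gamma^2 may coincide, but
p is small enough for the bound that a nonzero residue is at least 1. *)
Lemma escape_parameters (p : nat) (gamma : 'F_p) : prime p -> (3 <= p)%N ->
  (p.-1).-primitive_root gamma ->
  exists n M, [/\ (0 < n)%N, (0 < M)%N, escapes gamma n M, escapes (gamma ^+ 2) n M &
    (3 * (trunc_log 2 p + 2) * (1 + 162 * (M ^ 2 * n * (n ^ 2 + 2)))
      <= 2 ^ (200 * mixing_exponent p))%N].
Proof.
move=> pp p3 prim; rewrite /mixing_exponent; set l := trunc_log 2 p.
set m := trunc_log 2 l.
have p0 := prime_gt0 pp.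
have [p4|p4] := ltnP p 4.
  have pE : p = 3%N by apply/eqP; rewrite eqn_leq p3 andbT -ltnS.
  have lE : l = 1%N by rewrite /l pE.
  exists 1%N, p; split => //; try exact: trivial_escape.
  have k0 := leq_maxl 1 (l %/ m); move: (maxn _ _) k0 => k k0; rewrite lE pE.
  have four i : (2 <= i)%N -> (3 <= 2 ^ (i * k))%N.
    move=> i2; rewrite (@leq_trans (2 ^ 2)) // leq_pexp2l //.
    by rewrite (leq_trans i2) // leq_pmulr.
  by apply: cost_bound; rewrite ?expn_gt0 ?four.
have lp : (2 ^ l <= p)%N by rewrite trunc_logP.
have pl : (p < 2 ^ l.+1)%N by rewrite trunc_log_ltn.
have l2 : (2 <= l)%N by rewrite trunc_log_max.
have l0 : (0 < l)%N by apply: leq_trans l2.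
have m0 : (0 < m)%N by rewrite trunc_log_max.
have ml : (2 ^ m <= l)%N by rewrite trunc_logP.
have lm : (l < 2 ^ m.+1)%N by rewrite trunc_log_ltn.
have mm : (m < 2 ^ m)%N by rewrite ltn_expl.
set h := (l %/ m)%N; have h0 : (0 < h)%N.
  by rewrite divn_gt0 // (leq_trans (ltnW mm) ml).
rewrite (maxn_idPr h0).
have hb : (m * (m + 2) <= 16 * h)%N := exponent_bound m0 ml.
have pow2 a b : (a <= b -> 2 ^ a <= 2 ^ b)%N by move=> ab; rewrite leq_pexp2l.
pose T := ((4 * m) ^ m)%N.
have T0 : (0 < T)%N by rewrite expn_gt0 muln_gt0 m0.
have Th : (T <= 2 ^ (16 * h))%N.
  apply: leq_trans (pow2 _ _ hb); rewrite mulnC expnM /T leq_exp2r //.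
  by rewrite addnC expnD leq_mul2l (ltnW mm) orbT.
have lh : (l + 2 <= 2 ^ (32 * h))%N.
  by apply: (@leq_trans (2 ^ m.+2)); [rewrite expnS; lia|apply: pow2; nia].
have [Tp|Tp] := ltnP (2 * T) p.-1; last first.
  exists 1%N, p; split => //; try exact: trivial_escape.
  apply: cost_bound => //; last by rewrite expn_gt0.
  apply: (@leq_trans (2 ^ 2 * 2 ^ (16 * h))); last by rewrite -expnD pow2 //; lia.
  by rewrite (_ : 2 ^ 2 = 4)%N //; lia.
have mh : (m.+1 <= 16 * h)%N by nia.
have pH : (p < (2 ^ h.+1).+1 ^ m.+1)%N.
  apply: leq_trans pl _; apply: (@leq_trans ((2 ^ h.+1) ^ m.+1));
    last by rewrite leq_exp2r.
  by rewrite -expnM pow2 //; have := ltn_ceil l m0; rewrite -/h; nia.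
exists (m + l.+1 * T)%N, (m.+1 * 2 ^ h.+1)%N; split.
- by rewrite addn_gt0 m0.
- by rewrite muln_gt0 expn_gt0.
- apply: escapes_of_inj => //; first exact: ltnW.
  by rewrite -[gamma]expr1; apply: prim_root_inj prim => //; rewrite -/T; lia.
- apply: escapes_of_inj => //; first exact: ltnW.
  by apply: prim_root_inj prim.
- apply: cost_bound => //.
    apply: (@leq_trans (2 ^ (16 * h) * 2 ^ h.+1)); last by rewrite -expnD pow2 //; lia.
    by rewrite leq_mul2r (leq_trans mm) ?orbT // pow2 //; lia.
  have : (l.+1 * T <= 2 ^ (16 * h) * 2 ^ (16 * h))%N.
    by rewrite leq_mul // (leq_trans lm) // pow2.
  have : (m <= 2 ^ (16 * h))%N by rewrite (leq_trans (ltnW mm)) // pow2 //; lia.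
  rewrite -expnD -mulnDl => h1 h2.
  have h3 : (2 ^ (16 * h) <= 2 ^ ((16 + 16) * h))%N by rewrite pow2 //; lia.
  apply: (@leq_trans (2 * 2 ^ ((16 + 16) * h))); first by lia.
  by rewrite -expnS pow2 //; lia.
Qed.

Section Growth.
Variable R : realType.

Lemma ln2_ge : 1 / 2 <= ln 2 :> R.
Proof.
rewrite -ler_expR lnK ?posrE //.
have := expR_ge1Dx (- (1 / 2) : R); rewrite expRN => h.
have e0 := expR_gt0 (1 / 2 : R).
have : (expR (1 / 2))^-1 * expR (1 / 2) = 1 :> R by rewrite mulVf ?gt_eqF.
by nra.
Qed.

Lemma ln2_le : ln 2 <= 1 :> R.
Proof. by have := @le_ln1Dx R 1; rewrite -[1 + 1]/(2%:R); apply; lra. Qed.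

Lemma le_log2 (k n : nat) : (2 ^ k <= n)%N -> k%:R <= log2 n%:R :> R.
Proof.
move=> kn; have n0 : (0 < n)%N by apply: leq_trans kn; rewrite expn_gt0.
rewrite /log2 ler_pdivlMr; last by have := ln2_ge; lra.
rewrite mulr_natl -lnXn // ler_ln ?posrE ?exprn_gt0 ?ltr0n //.
by rewrite -natrX ler_nat.
Qed.

Lemma log2_lt (k : nat) (x : R) : 0 < x -> x < 2 ^+ k -> log2 x < k%:R.
Proof.
move=> x0 xk; rewrite /log2 ltr_pdivrMr; last by have := ln2_ge; lra.
by rewrite mulr_natl -lnXn // ltr_ln ?posrE ?exprn_gt0.
Qed.

Lemma mixing_exponent_le (p : nat) : (3 <= p)%N ->
  (mixing_exponent p)%:R / 2 <= log2 p%:R / log2 (log2 p%:R) :> R.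
Proof.
move=> p3; set x := log2 p%:R; set y := log2 x.
have l2 := ln2_ge; have l2' := ln2_le.
have l20 : 0 < ln 2 :> R by lra.
have x1 : 1 < x.
  rewrite /x /log2 ltr_pdivlMr // mul1r ltr_ln ?posrE ?ltr0n ?ltr_nat //.
  by apply: leq_trans p3.
have x0 : 0 < x by lra.
have y0 : 0 < y by rewrite /y /log2 divr_gt0 // ln_gt0.
rewrite ler_pdivlMr // /mixing_exponent; set l := trunc_log 2 p; set m := trunc_log 2 l.
have yx : y / 2 <= x.
  have := ln_sublinear x0.
  rewrite /y /log2 ler_pdivrMr // ler_pdivrMr //; nra.
have [h0|h0] := leqP (l %/ m)%N 1; first by lra.
have m0 : (0 < m)%N by case: m h0 => //; rewrite divn0.
have lx : l%:R <= x by rewrite le_log2 // trunc_logP // (leq_trans _ p3).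
have ll : (l < 2 ^ m.+1)%N by rewrite trunc_log_ltn.
have xl : x < l.+1%:R.
  by apply: log2_lt; rewrite ?ltr0n ?(leq_trans _ p3) // -natrX ltr_nat trunc_log_ltn.
have ym : y <= m.+1%:R.
  apply/ltW/log2_lt => //; apply: lt_le_trans xl _.
  by rewrite -natrX ler_nat.
have hm : (l %/ m)%:R * m%:R <= l%:R :> R by rewrite -natrM ler_nat leq_trunc_div.
have m1 : 1 <= m%:R :> R by rewrite ler1n.
have : y <= 2 * m%:R by move: ym; rewrite -natr1; lra.
have : 0 <= (l %/ m)%:R :> R by [].
by nra.
Qed.

(** The mixing exponent is at most twice log p / log log p and 2 <= e, which turns
2^200 into the constant 400. *)
Lemma growth (p K : nat) : (3 <= p)%N ->
  (3 * (trunc_log 2 p + 2) * (1 + K) <= 2 ^ (200 * mixing_exponent p))%N ->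
  3 * (ln p%:R + 1) * (1 + K%:R) <=
  expR (400 * log2 p%:R / log2 (log2 p%:R)) :> R.
Proof.
move=> p3 Kp; apply: (@le_trans _ _ (2 ^ (200 * mixing_exponent p))%N%:R); last first.
  apply: (@le_trans _ _ (expR (400 * ((mixing_exponent p)%:R / 2)))); last first.
    by rewrite ler_expR -mulrA ler_pM2l // mixing_exponent_le.
  have -> : 400 * ((mixing_exponent p)%:R / 2) = (200 * mixing_exponent p)%:R :> R.
    by rewrite natrM; lra.
  rewrite -[X in expR X]mulr1 expRM_natl natrX.
  rewrite lerXn2r ?nnegrE ?expR_ge0 //.
  by have := expR_ge1Dx (1 : R); lra.
apply: le_trans (_ : (3 * (trunc_log 2 p + 2) * (1 + K))%N%:R <= _);
  last by rewrite ler_nat.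
rewrite !natrM !natrD ler_wpM2r ?addr_ge0 // ler_wpM2l //.
have p0 : (0 < p)%N by apply: leq_trans p3.
have : log2 p%:R < (trunc_log 2 p).+1%:R :> R.
  by apply: log2_lt; rewrite ?ltr0n // -natrX ltr_nat trunc_log_ltn.
have lp0 : 0 <= ln p%:R :> R by rewrite ln_ge0 // ler1n.
have l2 := ln2_ge; have l2' := ln2_le.
rewrite /log2 ltr_pdivrMr; last by lra.
rewrite -natr1; set L := (trunc_log 2 p)%:R => h.
have : 0 <= L by rewrite /L.
by nra.
Qed.

End Growth.

(** * Geometric decay of the deviation from uniformity *)

Lemma primitive_root_neq0 (p : nat) (gamma : 'F_p) : prime p ->
  (p.-1).-primitive_root gamma -> gamma != 0.
Proof.
move=> pp prim; apply: contraTneq prim => ->; apply/negP => /prim_expr_order /eqP.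
by rewrite expr0n -subn1 subn_eq0 leqNgt prime_gt1 //= eq_sym oner_eq0.
Qed.

Section Deviation.
Variables (R : realType) (p : nat) (nu : 'F_p -> R) (x0 : 'F_p).
Hypotheses (pp : prime p) (p3 : (3 <= p)%N) (x0_neq0 : x0 != 0).
Hypotheses (nu_ge0 : forall e, 0 <= nu e) (nu0 : nu 0 = 0).
Hypothesis nu1 : \sum_e nu e = 1.

Let p1 : 1 < p%:R :> R. Proof. by rewrite ltr1n prime_gt1. Qed.

Lemma push_law n y :
  law nu (fun e x => fstar x * e) x0 n y = iter n (push nu) (fun y => (x0 == y)%:R) y.
Proof.
elim: n y => //= n IH y; apply: eq_bigr => e _.
have [->|e0] := eqVneq e 0; first by rewrite nu0 !mul0r.
rewrite (bigD1 (fstar (y / e))) //= fstar_invol mulfVK // eqxx mul1r IH big1 ?addr0 //.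
move=> x xy; case: eqP => [E|_]; last by rewrite mul0r.
by case/eqP: xy; rewrite -E mulfK // fstar_invol.
Qed.

Lemma lazy_push_law n y :
  law (fun eb => nu eb.1 * uniform_weight R [set: bool]%SET eb.2)
      (fun eb x => if eb.2 then fstar x * eb.1 else x) x0 n y =
  iter n (lazy_push nu) (fun y => (x0 == y)%:R) y.
Proof.
elim: n y => //= n IH y.
rewrite -(pair_big xpredT xpredT (fun e b => nu e * uniform_weight R [set: bool]%SET b *
  \sum_x ((if b then fstar x * e else x) == y)%:R * law _ _ x0 n x)) /=.
have half b : uniform_weight R [set: bool]%SET b = 1 / 2.
  by rewrite /uniform_weight inE cardsT card_bool mul1r.
set q := law _ _ _ _.
have stay : \sum_x (x == y)%:R * q x = q y.
  rewrite (bigD1 y) //= eqxx mul1r big1 ?addr0 // => x /negPf->.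
  by rewrite mul0r.
have inner e : \sum_b nu e * uniform_weight R [set: bool]%SET b *
    (\sum_x ((if b then fstar x * e else x) == y)%:R * q x) =
    (nu e * q y + nu e * q (fstar (y / e))) / 2.
  rewrite big_bool /= stay !half; have [->|e0] := eqVneq e 0; first by rewrite nu0; ring.
  rewrite (bigD1 (fstar (y / e))) //= fstar_invol mulfVK // eqxx !mul1r big1;
    first by field.
  move=> x xy; case: eqP => [E|_]; last by rewrite mul0r.
  by case/eqP: xy; rewrite -E mulfK // fstar_invol.
under eq_bigr => e _ do rewrite inner.
rewrite -mulr_suml big_split -mulr_suml nu1 mul1r /= /lazy_push /push; congr (_ / _).
by rewrite /q IH; congr (_ + _); apply: eq_bigr => e _; rewrite /= IH.
Qed.

Definition unif (y : 'F_p) : R := (y != 0)%:R / (p%:R - 1).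
Definition deviation (y : 'F_p) : R := (x0 == y)%:R - unif y.

Lemma push_unif y : push nu unif y = unif y.
Proof.
rewrite -[RHS]mul1r -nu1 mulr_suml; apply: eq_bigr => e _.
have [->|e0] := eqVneq e 0; first by rewrite nu0 !mul0r.
congr (_ * (_%:R / _)); rewrite -(inj_eq (@fstar_inj p)) fstar_invol fstar0.
by rewrite mulf_eq0 invr_eq0 (negPf e0) orbF.
Qed.

Lemma push_deviation n y : iter n (push nu) deviation y =
  iter n (push nu) (fun y => (x0 == y)%:R) y - unif y.
Proof.
elim: n y => //= n IH y; rewrite -push_unif -sumrB; apply: eq_bigr => e _.
by rewrite IH mulrBr.
Qed.

Lemma lazy_push_deviation n y : iter n (lazy_push nu) deviation y =
  iter n (lazy_push nu) (fun y => (x0 == y)%:R) y - unif y.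
Proof.
elim: n y => //= n IH y; rewrite /lazy_push IH.
have -> : push nu (iter n (lazy_push nu) deviation) y =
    push nu (iter n (lazy_push nu) (fun y => (x0 == y)%:R)) y - unif y.
  rewrite -push_unif -sumrB; apply: eq_bigr => e _; by rewrite IH mulrBr.
by lra.
Qed.

Lemma sum_unif (A : {set 'F_p}) : A \subset Fpstar p ->
  \sum_(y in A) unif y = #|A|%:R / (p%:R - 1).
Proof.
move=> AF; rewrite -mulr_suml; congr (_ / _); rewrite -sum1_card natr_sum.
by apply: eq_bigr => y /(fintype.subsetP AF); rewrite inE => ->.
Qed.

Lemma card_Fpstar : #|Fpstar p| = p.-1.
Proof.
have := cardsC1 (0 : 'F_p); rewrite card_Fp // => <-.
by apply: eq_card => y; rewrite !inE.
Qed.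

Lemma deviation0 : deviation 0 = 0.
Proof. by rewrite /deviation /unif eqxx mul0r (negPf x0_neq0) subrr. Qed.

Lemma sum_unif1 : \sum_y unif y = 1.
Proof.
have := sum_unif (subxx (Fpstar p)); rewrite card_Fpstar -subn1 natrB ?prime_gt0 //.
rewrite divff ?subr_eq0 ?gt_eqF // => <-; rewrite [RHS]big_mkcond.
apply: eq_bigr => y _; rewrite inE; case: eqP => // ->.
by rewrite /unif eqxx mul0r.
Qed.

Lemma sum_deviation : \sum_y deviation y = 0.
Proof.
rewrite sumrB sum_unif1 (bigD1 x0) //= eqxx big1 ?addr0 ?subrr // => y.
by rewrite eq_sym => /negPf->.
Qed.

Lemma energy_deviation_le : energy deviation <= 2.
Proof.
have u2 y : unif y ^+ 2 <= unif y.
  have : 1 / (p%:R - 1) <= 1 :> R.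
    rewrite ler_pdivrMr ?subr_gt0 // mul1r lerBrDr -(natrD _ 1 1) ler_nat.
    exact: leq_trans p3.
  rewrite /unif; have : 0 < 1 / (p%:R - 1) :> R by rewrite divr_gt0 ?subr_gt0.
  by case: eqP => _ /=; rewrite ?mul0r ?expr0n //; nra.
have d1 : \sum_y (x0 == y)%:R = 1 :> R.
  by have := sum_deviation; rewrite sumrB sum_unif1 => /eqP; rewrite subr_eq0 => /eqP.
have -> : 2 = \sum_y ((x0 == y)%:R + unif y) by rewrite big_split /= d1 sum_unif1.
apply: ler_sum => y _.
have u0 : 0 <= unif y by rewrite divr_ge0 // subr_ge0 ltW.
rewrite /deviation; have := u2 y.
by move: (unif y) u0 => u u0; case: eqP => _; rewrite ?mulr1n ?mulr0n => uu; nra.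
Qed.


Lemma relative_decay (K : nat) (a b : R) : b <= a -> a <= K%:R * (a - b) ->
  b <= (1 - (1 + K%:R)^-1) * a.
Proof.
move=> ba aK; have K1 : 0 < 1 + K%:R :> R by rewrite ltr_pwDl.
have -> : 1 - (1 + K%:R)^-1 = K%:R / (1 + K%:R) :> R by field; rewrite gt_eqF.
by rewrite mulrAC ler_pdivlMr //; nra.
Qed.

Lemma lazy_push_energy_le e g : 1 / 2 <= nu e -> energy (lazy_push nu g) <= energy g.
Proof.
move=> e2; have := lazy_push_drop nu_ge0 nu0 nu1 g e2.
by have := energy_ge0 (fun y => g (fstar (y / e)) - g y); lra.
Qed.

Section Rate.
Variables (gamma : 'F_p) (n M : nat).
Hypotheses (prim : (p.-1).-primitive_root gamma) (n0 : (0 < n)%N) (M0 : (0 < M)%N).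
Let K := (162 * (M ^ 2 * n * (n ^ 2 + 2)))%N.
Let rho : R := (1 + K%:R)^-1.

Let KE : K%:R = 162 * gap_cost R n M :> R.
Proof. by rewrite /K /gap_cost !natrM natrD !natrX. Qed.

Let rho1 : 0 <= 1 - rho.
Proof. by rewrite subr_ge0 invf_le1 ?lerDl // ltr_pwDl. Qed.

Let gamma0 : gamma != 0 := primitive_root_neq0 pp prim.

Let gammaX i : (0 < i < p.-1)%N -> gamma ^+ i != 1.
Proof.
case/andP=> i0 ip; rewrite -(prim_order_dvd prim); apply/negP => /dvdn_leq.
by move=> /(_ i0); rewrite leqNgt ip.
Qed.

(** Only pairs of steps are known to lose energy; a last odd step does not
increase it. *)
Lemma push_rate k : 1 / 3 <= nu gamma -> 1 / 3 <= nu 1 -> escapes gamma n M ->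
  energy (iter k (push nu) deviation) <= 2 * (1 - rho) ^+ k./2.
Proof.
move=> cg c1 esc.
have at0 j : iter j (push nu) deviation 0 = 0.
  by elim: j => [|j IH]; rewrite /= ?deviation0 ?push0.
have sum0 j : \sum_y iter j (push nu) deviation y = 0.
  by elim: j => [|j IH]; rewrite /= ?sum_deviation ?sum_push.
have two j : energy (iter j.*2 (push nu) deviation) <= 2 * (1 - rho) ^+ j.
  elim: j => [|j IH]; first by rewrite expr0 mulr1 energy_deviation_le.
  rewrite doubleS exprS mulrCA; apply: le_trans (ler_wpM2l rho1 IH).
  apply: relative_decay.
    by rewrite !iterS (le_trans (push_energy_le _ _ _ _)) ?push_energy_le.
  rewrite KE [162 * _]mulrC -mulrA !iterS.
  apply: (push2_decay pp nu_ge0 nu0 nu1 gamma0 _ cg c1 esc) => //.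
  by rewrite -[gamma]expr1 gammaX //=; lia.
rewrite -{1}(odd_double_half k) iterD; case: (odd k) => //=.
by apply: le_trans (push_energy_le _ _ _ _) _.
Qed.

Lemma lazy_push_rate k : 1 / 2 <= nu gamma -> 1 / 2 <= nu gamma^-1 ->
  escapes (gamma ^+ 2) n M ->
  energy (iter k (lazy_push nu) deviation) <= 2 * (1 - rho) ^+ k./2.
Proof.
move=> cg cV esc.
have at0 j : iter j (lazy_push nu) deviation 0 = 0.
  by elim: j => [|j IH]; rewrite /= ?deviation0 ?lazy_push0.
have sum0 j : \sum_y iter j (lazy_push nu) deviation y = 0.
  by elim: j => [|j IH]; rewrite /= ?sum_deviation ?sum_lazy_push.
have step j : energy (iter j.+1 (lazy_push nu) deviation) <=
    (1 - rho) * energy (iter j (lazy_push nu) deviation).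
  have le := lazy_push_energy_le (iter j (lazy_push nu) deviation) cg.
  apply: relative_decay => //.
  have [p3'|p4] := leqP p 3.
    have pE : p = 3%N by apply/eqP; rewrite eqn_leq p3' p3.
    have p2 : p.-1 = 2%N by rewrite pE.
    have gE : gamma = -1.
      have := prim_expr_order prim; rewrite p2 => /eqP.
      rewrite sqrf_eq1 => /orP[/eqP g1|/eqP//].
      have /gammaX : (0 < 1 < p.-1)%N by rewrite p2.
      by rewrite expr1 g1 eqxx.
    apply: (@le_trans _ _ (4 * (energy (iter j (lazy_push nu) deviation) -
      energy (iter j.+1 (lazy_push nu) deviation)))).
      exact: lazy_push_decay3 pE nu_ge0 nu0 nu1 cg gE (at0 j) (sum0 j).
    rewrite ler_wpM2r ?subr_ge0 // ler_nat /K.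
    apply: (@leq_trans (162 * 1)); rewrite // leq_mul2l !muln_gt0 M0 n0 addn_gt0.
    by rewrite !orbT.
  apply: le_trans (lazy_push_decay pp nu_ge0 nu0 nu1 gamma0 _ cg cV esc _ _) _ => //.
    rewrite gammaX //=; have := prime_gt1 pp.
    suff : p != 4%N by lia.
    by apply: contraTneq pp => ->.
  rewrite KE [162 * _]mulrC -[leRHS]mulrA ler_wpM2l ?gap_cost_ge0 //.
  rewrite ler_wpM2r ?subr_ge0 //.
  by rewrite ler_nat.
have all j : energy (iter j (lazy_push nu) deviation) <= 2 * (1 - rho) ^+ j.
  elim: j => [|j IH]; first by rewrite expr0 mulr1 energy_deviation_le.
  by apply: le_trans (step j) _; rewrite exprS mulrCA ler_wpM2l.
apply: le_trans (all k) _; rewrite ler_pM2l //.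
apply: ler_wiXn2l => //; last by lia.
by rewrite gerBl invr_ge0 addr_ge0.
Qed.

End Rate.

End Deviation.

(** * From energy to total variation *)

Section Mixing.
Context d (T : measurableType d) (R : realType) (P : probability T R).
Variables (p : nat) (Z : T -> 'F_p) (g : 'F_p -> R).
Hypotheses (pp : prime p) (p3 : (3 <= p)%N).
Hypothesis lawZ : forall A : {set 'F_p}, measurable [set w | Z w \in A] /\
  P [set w | Z w \in A] = (\sum_(y in A) (g y + unif R y))%:E.

Lemma dist_to_uniform_le (b : R) :
  (forall A : {set 'F_p}, A \subset Fpstar p ->
    `|fine (P [set w | Z w \in A]) - #|A|%:R / (p%:R - 1)| <= 2 * b) ->
  0 <= b -> dist_to_uniform P Z <= b.
Proof.
move=> h b0; rewrite /dist_to_uniform ler_pdivrMl //.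
by apply/bigmax_leP; split=> [|A /h//]; rewrite mulr_ge0.
Qed.

Lemma dist_le_half : dist_to_uniform P Z <= 1 / 2.
Proof.
apply: dist_to_uniform_le => [A AF|]; last by rewrite divr_ge0.
have p1 : 0 < p%:R - 1 :> R by rewrite subr_gt0 ltr1n prime_gt1.
have [mA _] := lawZ A.
have P1 := @probability_le1 _ _ _ P _ mA.
have P0 : (0 <= P [set w | Z w \in A])%E := measure_ge0 P _.
have fP : P [set w | Z w \in A] \is a fin_num by exact: fin_num_measure.
rewrite -(fineK fP) lee_fin in P1; rewrite -(fineK fP) lee_fin in P0.
have U0 : 0 <= #|A|%:R / (p%:R - 1) :> R by rewrite divr_ge0 // ltW.
have U1 : #|A|%:R / (p%:R - 1) <= 1 :> R.
  rewrite ler_pdivrMr // mul1r lerBrDr -(natrD _ _ 1) ler_nat.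
  by have := subset_leq_card AF; rewrite card_Fpstar //; lia.
by rewrite ler_norml; lra.
Qed.

Lemma dist_le_energy (b : R) : 0 <= b -> p%:R * energy g <= 4 * b ^+ 2 ->
  dist_to_uniform P Z <= b.
Proof.
move=> b0 gb; apply: dist_to_uniform_le => // A AF.
have [_ ->] := lawZ A; rewrite /= big_split /= sum_unif // addrK.
rewrite -(ler_pXn2r (_ : 0 < 2)%N) ?nnegrE ?mulr_ge0 // real_normK ?num_real //.
rewrite exprMn (_ : 2 ^+ 2 = 4 :> R); last by rewrite -natrX.
apply: le_trans gb; rewrite big_mkcond /=.
have := sqr_sum_le (fun y => if y \in A then g y else 0); rewrite card_Fp //.
move/le_trans; apply; rewrite ler_wpM2l //; apply: ler_sum => y _.
by case: ifP => // _; rewrite expr0n /= sqr_ge0.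
Qed.

(** For c <= 1 the trivial bound 1/2 is enough.  For c > 1, the number n/2 of
double steps is at least (ln p + c) (1 + K), and exp (- ln p) absorbs the
factor p. *)
Lemma dist_decay (K n : nat) (c E : R) :
  energy g <= 2 * (1 - (1 + K%:R)^-1) ^+ n./2 ->
  3 * (ln p%:R + 1) * (1 + K%:R) <= E -> 0 < c -> n%:R = c * E ->
  dist_to_uniform P Z <= expR (- (2^-1 * c)).
Proof.
move=> gE Kp c0 nE; have [c1|c1] := leP c 1.
  apply: le_trans dist_le_half _; have := expR_ge1Dx (- (2^-1 * c)); lra.
apply: dist_le_energy; first exact: expR_ge0.
have p0 : 0 < p%:R :> R by rewrite ltr0n prime_gt0.
have lp0 : 0 <= ln p%:R :> R by rewrite ln_ge0 // ler1n prime_gt0.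
have K1 : 1 <= 1 + K%:R :> R by rewrite lerDl.
set rho := (1 + K%:R)^-1 in gE.
have rho0 : 0 < rho by rewrite invr_gt0; lra.
have rhoK : rho * (1 + K%:R) = 1 by rewrite mulVf // gt_eqF //; lra.
have rho1 : rho <= 1 by nra.
have E3 : 3 <= E by nra.
have n3 : (3 <= n)%N by rewrite -(ler_nat R) nE; nra.
have half : n%:R <= 3 * (n./2)%:R :> R by rewrite -natrM ler_nat; lia.
have Erho : 3 * (ln p%:R + 1) <= rho * E.
  by have := ler_wpM2l (ltW rho0) Kp; rewrite mulrCA rhoK mulr1.
have expo : ln p%:R + c <= rho * (n./2)%:R.
  have : c * (3 * (ln p%:R + 1)) <= 3 * (rho * (n./2)%:R) by nra.
  by nra.
have pow : (1 - rho) ^+ n./2 <= expR (- rho * (n./2)%:R).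
  rewrite [_ * _%:R]mulrC expRM_natl lerXn2r ?nnegrE ?expR_ge0 ?subr_ge0 //.
  exact: expR_ge1Dx.
have -> : expR (- (2^-1 * c)) ^+ 2 = expR (- c).
  by rewrite -expRM_natl; congr expR; lra.
have : p%:R * expR (- rho * (n./2)%:R) <= expR (- c).
  rewrite -{1}(lnK (_ : p%:R \is Num.pos)) ?posrE // -expRD ler_expR; lra.
have := expR_gt0 (- c).
have : p%:R * energy g <= 2 * (p%:R * expR (- rho * (n./2)%:R)).
  by rewrite mulrCA ler_pM2l // (le_trans gE) // ler_pM2l.
by lra.
Qed.

End Mixing.

Lemma sum_uniform_weight (R : realType) (E : finType) (S : {set E}) :
  (0 < #|S|)%N -> \sum_e uniform_weight R S e = 1.
Proof.
move=> S0; rewrite -big_mkcond sumr_const -[_ *+ _]mulr_natl divff //.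
by rewrite pnatr_eq0 -lt0n.
Qed.

Lemma uniform_weight_ge (R : realType) (E : finType) (S : {set E}) (k : nat) e :
  e \in S -> (#|S| <= k)%N -> 1 / k%:R <= uniform_weight R S e.
Proof.
move=> eS Sk; rewrite /uniform_weight eS mul1r.
have S0 : (0 < #|S|)%N by rewrite card_gt0; apply/set0Pn; exists e.
by rewrite lef_pV2 ?posrE ?ltr0n ?ler_nat // (leq_trans S0).
Qed.

Lemma uniform_weight_ge0 (R : realType) (E : finType) (S : {set E}) e :
  0 <= uniform_weight R S e.
Proof. by rewrite /uniform_weight; case: ifP. Qed.

Theorem theorem1 (R : realType) :
  exists C c0 : R, [/\ 0 < C, 0 < c0 &
  forall (p : nat) (gamma x0 : 'F_p),
    prime p -> (3 <= p)%N ->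
    (p.-1).-primitive_root gamma ->
    x0 \in Fpstar p ->
  forall (d : measure_display) (T : measurableType d) (P : probability T R)
    (eps : nat -> T -> 'F_p),
    (forall j, discrete_rv (eps j)) ->
    (* the lazy chain *)
    (forall move : nat -> T -> bool,
      (forall j, discrete_rv (move j)) ->
      (forall j, uniform_on P [set gamma; gamma^-1]%SET (eps j)) ->
      (forall j, uniform_on P [set: bool]%SET (move j)) ->
      independent_rvs2 P eps move ->
      forall (c : R) (n : nat), 0 < c -> (0 < n)%N ->
        n%:R = c * expR (C * log2 p%:R / log2 (log2 p%:R)) ->
        dist_to_uniform P (lazy_chain x0 eps move n) <= expR (- (c0 * c)))
    /\
    (* the chain without laziness *)
    ((forall j, uniform_on P [set 1; gamma^-1; gamma]%SET (eps j)) ->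
      independent_rvs P eps ->
      forall (c : R) (n : nat), 0 < c -> (0 < n)%N ->
        n%:R = c * expR (C * log2 p%:R / log2 (log2 p%:R)) ->
        dist_to_uniform P (chain x0 eps n) <= expR (- (c0 * c)))].
Proof.
exists 400, 2^-1; split=> [||p gamma x0 pp p3 prim]; rewrite ?invr_gt0 //.
rewrite inE => x0_neq0 d T P eps meps.
have [n0 [M [n00 M0 esc esc2 cost]]] := escape_parameters pp p3 prim.
have rate := growth R p3 cost.
have gamma_neq0 := primitive_root_neq0 pp prim.
split=> [move mmove ueps umove ind c n c0 _ nE | ueps ind c n c0 _ nE].
- set S := [set gamma; gamma^-1]%SET in ueps.
  have gS : gamma \in S by rewrite !inE eqxx.
  have gS' : gamma^-1 \in S by rewrite !inE eqxx orbT.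
  have S2 : (#|S| <= 2)%N by rewrite cards2; case: (_ != _).
  have nu0 : uniform_weight R S 0 = 0.
    by rewrite /uniform_weight !inE ![0 == _]eq_sym invr_eq0 (negPf gamma_neq0).
  have nu1 : \sum_e uniform_weight R S e = 1.
    by apply: sum_uniform_weight; rewrite card_gt0; apply/set0Pn; exists gamma.
  pose g := iter n (lazy_push (uniform_weight R S)) (deviation R x0).
  apply: (dist_decay (g := g) pp p3 _ _ rate c0 nE); last first.
    apply: (lazy_push_rate pp p3 x0_neq0 (uniform_weight_ge0 R S) nu0 nu1 prim n00 M0);
      rewrite ?uniform_weight_ge //.
  move=> A; have cyl := cylinder_independent2 meps mmove ueps umove ind.
  pose step (eb : 'F_p * bool) (x : 'F_p) := if eb.2 then fstar x * eb.1 else x.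
  have XS k w : lazy_chain x0 eps move k.+1 w =
    step (eps k w, move k w) (lazy_chain x0 eps move k w) by [].
  pose nu (eb : 'F_p * bool) :=
    uniform_weight R S eb.1 * uniform_weight R [set: bool]%SET eb.2.
  have [mX PX] := driven_law (nu := nu)
    (fun w => erefl (lazy_chain x0 eps move 0 w)) XS cyl n A.
  split => //; rewrite PX; congr _%:E; apply: eq_bigr => y _.
  by rewrite lazy_push_law // /g lazy_push_deviation // subrK.
- set S := [set 1; gamma^-1; gamma]%SET in ueps.
  have gS : gamma \in S by rewrite !inE eqxx orbT.
  have oS : 1 \in S by rewrite !inE eqxx.
  have S3 : (#|S| <= 3)%N.
    rewrite /S -finset.setUA cardsU1 cards2 (@leq_trans (1 + 2)) // leq_add //.
      by case: (_ \notin _).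
    by case: (_ != _).
  have nu0 : uniform_weight R S 0 = 0.
    by rewrite /uniform_weight !inE ![0 == _]eq_sym oner_eq0 invr_eq0 (negPf gamma_neq0).
  have nu1 : \sum_e uniform_weight R S e = 1.
    by apply: sum_uniform_weight; rewrite card_gt0; apply/set0Pn; exists gamma.
  pose g := iter n (push (uniform_weight R S)) (deviation R x0).
  apply: (dist_decay (g := g) pp p3 _ _ rate c0 nE); last first.
    apply: (push_rate pp p3 x0_neq0 (uniform_weight_ge0 R S) nu0 nu1 prim n00 M0);
      rewrite ?uniform_weight_ge //.
  move=> A; have cyl := cylinder_independent meps ueps ind.
  pose step (e x : 'F_p) := fstar x * e.
  have XS k w : chain x0 eps k.+1 w = step (eps k w) (chain x0 eps k w) by [].
  have [mX PX] := driven_law (nu := uniform_weight R S)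
    (fun w => erefl (chain x0 eps 0 w)) XS cyl n A.
  split => //; rewrite PX; congr _%:E; apply: eq_bigr => y _.
  by rewrite push_law // /g push_deviation // subrK.
Qed.
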